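(* Let $(M,g)$ be an $n$-dimensional Riemannian manifold, $n\geq 3$, possibly with boundary, with $g\in C^r$, $r>2$. Let $Z=(Z^1,\ldots,Z^n)$ be conformal harmonic coordinates (with respect to $g$) on an open set $\Omega\subset M$, and let $f_g>0$ be a function on $\Omega$ with $L_gf_g=0$ such that the contracted Christoffel symbols of $g$ in the coordinates $Z$ satisfy $\Gamma_a(g)=2\,\partial_a\log f_g$, $a=1,\ldots,n$. Let $c\in C^r(M)$ be a positive function. Then the contracted Christoffel symbols of the conformally scaled metric $cg$ in the coordinates $Z$ satisfy $$\Gamma_a(cg)=2\,\partial_a\log f_{cg},\qquad a=1,\ldots,n,$$ where $f_{cg}=c^{-\frac{n-2}{4}}f_g$ is a positive function that satisfies $L_{cg}f_{cg}=0$.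
   Context: Christoffel symbols $\Gamma_{ab}^c(g)=\frac12g^{cd}(\partial_ag_{bd}+\partial_bg_{ad}-\partial_dg_{ab})$; contracted Christoffel symbols $\Gamma^a=g^{bc}\Gamma_{bc}^a$ and $\Gamma_a=g_{ab}\Gamma^b$ (everything computed with the indicated metric). $L_g=\Delta_g+\frac{n-2}{4(n-1)}R(g)$, where $\Delta_gu=-|g|^{-1/2}\partial_a(|g|^{1/2}g^{ab}\partial_bu)$, $|g|=\det(g_{ab})$, and $R(g)$ is the scalar curvature. Conformal harmonic coordinates on $\Omega$: coordinates $(Z^1,\ldots,Z^n)$ on $\Omega$ such that $Z^k=f^k/f$, $k=1,\ldots,n$, for some $C^2$ functions $f^k$ and $f>0$ on $\Omega$ with $L_gf^k=L_gf=0$ on $\Omega$ (for such coordinates a function $f_g$ as in the claim exists, e.g. $f_g=f$). Near boundary points coordinates are boundary coordinate systems, i.e. they map into $\{x^n\geq 0\}$ and map the boundary into $\{x^n=0\}$. *)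

(* Defs.v *)
From HB Require Import structures.
From mathcomp Require Import all_boot all_order all_algebra.
From mathcomp Require Import all_classical all_reals all_analysis.

Set Implicit Arguments.
Unset Strict Implicit.
Unset Printing Implicit Defensive.

Import Order.TTheory GRing.Theory Num.Theory.
Import numFieldNormedType.Exports.

Local Open Scope classical_set_scope.
Local Open Scope ring_scope.

(* Calculus on the images D of coordinate systems.  D need not be open in R^n:
   near a boundary point it is a half space.  Derivatives are therefore taken
   within D: two-sided (the library's 'D_v) at interior points, one-sided in
   the normal direction at boundary points. *)
Section Calculus.
Context {R : realType} {n : nat}.
Implicit Types (D : set 'rV[R]_n) (f : 'rV[R]_n -> R) (x : 'rV[R]_n).
Implicit Type a : 'I_n.

Definition half_space : set 'rV[R]_n :=
  [set x | forall i : 'I_n, i.+1 = n -> 0 <= x ord0 i].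

Definition half_space_bdry : set 'rV[R]_n :=
  [set x | forall i : 'I_n, i.+1 = n -> x ord0 i = 0].

Definition coord_domain D : Prop := forall x, D x ->
  nbhs x D \/
  (half_space_bdry x /\ \forall y \near x, (D y <-> half_space y)).

Definition diff_quot f x a (h : R) : R :=
  h^-1 * (f (x + h *: delta_mx ord0 a) - f x).

Definition dir_nbhs D x a : set_system R :=
  within [set h | D (x + h *: delta_mx ord0 a)] 0^'.

Definition pderivable D a f x : Prop :=
  cvg (diff_quot f x a @ dir_nbhs D x a).

Definition pd D a f x : R := lim (diff_quot f x a @ dir_nbhs D x a).

(* f has continuous partial derivatives up to order k on D, and those of order
   exactly k satisfy P. *)
Fixpoint Ck_with (P : ('rV[R]_n -> R) -> Prop) (k : nat) D f : Prop :=
  {within D, continuous f} /\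
  match k with
  | 0 => P f
  | k'.+1 => (forall a x, D x -> pderivable D a f x) /\
             (forall a, Ck_with P k' D (pd D a f))
  end.

Definition Ck (k : nat) D f : Prop := Ck_with (fun _ => True) k D f.

Definition locally_holder (alpha : R) D f : Prop :=
  forall x, D x -> exists C : R, \forall y \near x & z \near x,
    D y -> D z -> `|f y - f z| <= C * `|y - z| `^ alpha.

(* For r = k + alpha with 0 <= alpha < 1: the class C^k if alpha = 0, and the
   Hölder class C^{k,alpha} (locally uniformly) if 0 < alpha. *)
Definition Cr (r : R) D f : Prop :=
  let k := Num.truncn r in
  let alpha := r - k%:R in
  Ck_with (fun h => 0 < alpha -> locally_holder alpha D h) k D f.

End Calculus.

(* Classical formulas in coordinates, for a matrix field G = (g_{ab}) on D;
   invmx (G x) = (g^{ab}). *)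
Section CoordinateGeometry.
Context {R : realType} {n : nat}.
Variables (D : set 'rV[R]_n) (G : 'rV[R]_n -> 'M[R]_n).
Implicit Types (a b c d : 'I_n) (x : 'rV[R]_n).

Definition ginv a b x : R := invmx (G x) a b.

(* Gamma_{ab}^c *)
Definition christoffel c a b x : R :=
  2^-1 * \sum_d ginv c d x *
    (pd D a (fun y => G y b d) x + pd D b (fun y => G y a d) x
     - pd D d (fun y => G y a b) x).

(* Gamma^a = g^{bc} Gamma_{bc}^a *)
Definition contracted_up a x : R :=
  \sum_b \sum_c ginv b c x * christoffel a b c x.

(* Gamma_a = g_{ab} Gamma^b *)
Definition contracted_down a x : R :=
  \sum_b G x a b * contracted_up b x.

Definition ricci a b x : R :=
  \sum_c (pd D c (christoffel c a b) x - pd D b (christoffel c a c) x)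
  + \sum_c \sum_d (christoffel c c d x * christoffel d a b x
                   - christoffel c b d x * christoffel d a c x).

Definition scalar_curvature x : R :=
  \sum_a \sum_b ginv a b x * ricci a b x.

Definition sqrt_det x : R := Num.sqrt (\det (G x)).

(* The nonnegative Laplacian. *)
Definition laplacian (u : 'rV[R]_n -> R) x : R :=
  - ((sqrt_det x)^-1 *
     \sum_a pd D a (fun y =>
       sqrt_det y * \sum_b ginv a b y * pd D b u y) x).

Definition conf_laplacian_coord (u : 'rV[R]_n -> R) x : R :=
  laplacian u x
  + (n%:R - 2) / (4 * (n%:R - 1)) * scalar_curvature x * u x.

End CoordinateGeometry.

(* A coordinate map cmap on cdom, with inverse cinv; the values of cmap outside
   cdom and of cinv outside the image are irrelevant. *)
Record coords (R : realType) (n : nat) (T : Type) := Coords {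
  cdom : set T;
  cmap : T -> 'rV[R]_n;
  cinv : 'rV[R]_n -> T
}.

Definition cimage (R : realType) (n : nat) (T : Type) (C : coords R n T)
  : set 'rV[R]_n := cmap C @` cdom C.

Definition is_coords (R : realType) (n : nat) (T : topologicalType)
    (C : coords R n T) : Prop :=
  [/\ open (cdom C),
      forall p, cdom C p -> cinv C (cmap C p) = p,
      {within cdom C, continuous (cmap C)},
      {within cimage C, continuous (cinv C)} &
      coord_domain (cimage C)].

(* The coordinate change C' o C^{-1} is of class C^k where defined. *)
Definition transition_Ck (R : realType) (n : nat) (T : Type) (k : nat)
    (C C' : coords R n T) : Prop :=
  forall a : 'I_n, Ck k (cmap C @` (cdom C `&` cdom C'))
                     (fun x => cmap C' (cinv C x) ord0 a).

(* Smooth n-manifolds, possibly with boundary.  chart_at selects one chart of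
   the atlas around each point. *)
Record smooth_manifold (R : realType) (n : nat) := SmoothManifold {
  point :> topologicalType;
  chart_index : Type;
  chart : chart_index -> coords R n point;
  chart_at : point -> chart_index;
  manifold_hausdorff : hausdorff_space point;
  manifold_second_countable : @second_countable point;
  chart_is_coords : forall i, is_coords (chart i);
  chart_atP : forall p, cdom (chart (chart_at p)) p;
  chart_smooth : forall i j k, transition_Ck k (chart i) (chart j)
}.

Section Manifold.
Context {R : realType} {n : nat} {M : smooth_manifold R n}.
Implicit Types (C : coords R n M) (u : M -> R) (p : M) (V : set M).

Definition boundary : set M :=
  [set p | exists2 i, cdom (chart i) p &
           ~ nbhs (cmap (chart i) p) (cimage (chart i))].

Definition Ck_on (k : nat) V u : Prop := forall i : chart_index M,
  Ck k (cmap (chart i) @` (cdom (chart i) `&` V)) (u \o cinv (chart i)).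

Definition Cr_on (r : R) V u : Prop := forall i : chart_index M,
  Cr r (cmap (chart i) @` (cdom (chart i) `&` V)) (u \o cinv (chart i)).

(* The partial derivative of u with respect to the a-th coordinate of C. *)
Definition partial C (a : 'I_n) u p : R :=
  pd (cimage C) a (u \o cinv C) (cmap C p).

(* A tensor field of type (0,2) is given at p by its matrix in the selected
   chart at p; tensor_comp gives its components in arbitrary coordinates C,
   by the tensor transformation law J^T g J with
   J_{ca} = d(chart coordinate c)/d(C coordinate a). *)
Definition tensor2 := M -> 'M[R]_n.

Definition jacobian C p : 'M[R]_n :=
  \matrix_(c, a)
    partial C a (fun q => cmap (chart (chart_at p)) q ord0 c) p.

Definition tensor_comp (g : tensor2) C (x : 'rV[R]_n) : 'M[R]_n :=
  let p := cinv C x in (jacobian C p)^T *m g p *m jacobian C p.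

Definition riemannian_metric (r : R) (g : tensor2) : Prop :=
  [/\ forall p, (g p)^T = g p,
      forall p (v : 'rV[R]_n), v != 0 -> 0 < (v *m g p *m v^T) ord0 ord0 &
      forall (i : chart_index M) (a b : 'I_n),
        Cr r (cimage (chart i)) (fun x => tensor_comp g (chart i) x a b)].

Definition conf_scale (c : M -> R) (g : tensor2) : tensor2 :=
  fun p => c p *: g p.

(* Gamma_a(g) in the coordinates C. *)
Definition contracted_christoffel (g : tensor2) C (a : 'I_n) p : R :=
  contracted_down (cimage C) (tensor_comp g C) a (cmap C p).

(* L_g u, which is independent of the chart used. *)
Definition conf_laplacian (g : tensor2) u p : R :=
  let C := chart (chart_at p) in
  conf_laplacian_coord (cimage C) (tensor_comp g C) (u \o cinv C) (cmap C p).

(* Classical solutions of L_g u = 0 on V. *)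
Definition conf_laplace_solution (g : tensor2) V u : Prop :=
  Ck_on 2 V u /\ forall p, V p -> conf_laplacian g u p = 0.

(* C^2 coordinates on the open set cdom Z: a C^2 diffeomorphism onto its image
   in both directions, and a boundary coordinate system near boundary points. *)
Definition C2_coordinates (Z : coords R n M) : Prop :=
  [/\ is_coords Z,
      forall i, transition_Ck 2 (chart i) Z,
      forall i, transition_Ck 2 Z (chart i) &
      forall p, cdom Z p -> boundary p ->
        half_space_bdry (cmap Z p) /\ \forall q \near p, half_space (cmap Z q)].

Definition conf_harmonic_coordinates (g : tensor2) (Z : coords R n M) : Prop :=
  C2_coordinates Z /\
  exists (fk : 'I_n -> M -> R) (f : M -> R),
    [/\ forall p, cdom Z p -> 0 < f p,
        conf_laplace_solution g (cdom Z) f,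
        forall k, conf_laplace_solution g (cdom Z) (fk k) &
        forall k p, cdom Z p -> cmap Z p ord0 k = fk k p / f p].

End Manifold.

Arguments tensor2 {R n} M.

(* Main.v *)
Require Import Defs.
From HB Require Import structures.
From mathcomp Require Import all_boot all_order all_algebra.
From mathcomp Require Import all_classical all_reals all_analysis.
From mathcomp Require Import perm ring lra.
Set Implicit Arguments.
Unset Strict Implicit.
Unset Printing Implicit Defensive.
Import Order.TTheory GRing.Theory Num.Theory.
Import numFieldNormedType.Exports.
Local Open Scope classical_set_scope.
Local Open Scope ring_scope.

(** Write [phi_a] for the partial derivatives of [ln c].  Passing from [g] to
    [c g] adds to the Christoffel symbols the tensor
    [T^k_ab = 1/2 (phi_a delta^k_b + phi_b delta^k_a - g_ab phi^k)]
    ([christoffel_conf]).  Contracting it with the metric gives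
    [Gamma_a (c g) = Gamma_a (g) - (n-2)/2 phi_a] ([contracted_down_conf]), and
    [- (n-2)/2 phi_a] is exactly twice the derivative of [ln (c^s)] for
    [s = - (n-2)/4]: this is the law for the contracted symbols.

    The equation for [c^s f] is the conformal covariance
    [L_(cg) (c^s u) = c^(s-1) L_g u] ([conf_laplacian_coord_conf]).  It combines
    two formulas.  The curvature obeys
    [c R(cg) = R(g) - (n-1) div phi - (n-1)(n-2)/4 |phi|^2]
    ([scalar_curvature_conf]): the second derivatives of the metric drop out of
    the difference of the two Ricci tensors, and what remains is a polynomial
    identity between the metric, its inverse, the first derivatives of the
    metric, [phi] and the first derivatives of [phi], which is proved by moving
    indices around ([conf_curvature_algebra]).  The Laplacian is minus the
    divergence [d_k V^k + Gamma^d_dk V^k] of the gradient, because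
    [Gamma^d_dk] is the logarithmic derivative of [sqrt (det g)]
    ([laplacian_div], from Jacobi's formula [is_pd_det]); so both pieces of the
    divergence transform explicitly ([laplacian_conf]).  The exponent [s] is the
    one for which the terms of first order in [u] cancel, and the remaining
    multiples of [u] cancel against the curvature.

    Every partial derivative here is a limit of difference quotients, so each
    differentiation needs the existence of these limits.  Existence is known in
    the charts of the manifold, whereas the first claim lives in coordinates
    that are related to the charts by [C^2] transition maps.  The components of
    [g] in these coordinates are products of first derivatives of the transition
    map with components of [g] in a chart composed with the transition map
    ([tensor_comp_change]), and so a chain rule is required, at boundary points
    as well ([is_pd_chain]).  It is obtained by walking from one point to
    another one coordinate at a time, which never leaves a half space, and by
    applying the mean value theorem to each step ([slope_pd]). *)

(** * Partial derivatives within a domain *)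

Section PartialDerivatives.
Context {R : realType} {n : nat}.
Implicit Types (D W : set 'rV[R]_n) (f g : 'rV[R]_n -> R) (x y : 'rV[R]_n).
Implicit Types (a b i j : 'I_n) (l : R).

Definition is_pd D a f x l : Prop :=
  diff_quot f x a @ dir_nbhs D x a --> l.

#[global] Instance dir_nbhs_filter D x a : Filter (dir_nbhs D x a).
Proof. exact: within_filter. Qed.

Lemma shift_cvg x a : (fun h : R => x + h *: delta_mx ord0 a) @ 0 --> x.
Proof.
have : (fun h : R => x + h *: delta_mx ord0 a) @ 0 -->
    x + (0 : R) *: delta_mx ord0 a.
  by apply: cvgD; [exact: cvg_cst | apply: cvgZr_tmp; exact: cvg_id].
by rewrite scale0r addr0.
Qed.

Lemma half_space_shift x a (h : R) : half_space x -> 0 <= h ->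
  half_space (x + h *: delta_mx ord0 a).
Proof.
move=> hx h0 i iN; rewrite !mxE addr_ge0 ?hx// mulr_ge0//.
Qed.

Lemma half_space_bdryW x : half_space_bdry x -> half_space x.
Proof. by move=> hx i iN; rewrite hx. Qed.

(** Whether the point is interior or on the boundary, all small nonnegative
    steps in a coordinate direction stay in the domain: in the normal direction
    the half space lies on the nonnegative side.  Properness is what makes
    limits along [dir_nbhs], hence partial derivatives, unique. *)
Lemma dir_nbhs_proper D x a : coord_domain D -> D x ->
  ProperFilter (dir_nbhs D x a).
Proof.
move=> Dc Dx; apply: Build_ProperFilter_ex => P; rewrite /dir_nbhs /within /=.
have near0 (Q : set 'rV[R]_n) : nbhs x Q ->
    \forall h \near 0, Q (x + h *: delta_mx ord0 a).
  by move=> Qx; have := @shift_cvg x a Q Qx; rewrite near_simpl.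
have Dpos : \forall h \near (0 : R), 0 <= h -> D (x + h *: delta_mx ord0 a).
  case: (Dc _ Dx) => [/near0 Dn|[xb /near0 Dn]].
    by apply: filterS Dn => h + _.
  apply: filterS Dn => h Dh h0; apply/Dh; apply: half_space_shift => //.
  exact: half_space_bdryW.
rewrite near_withinE near_simpl => Pn.
have /nbhs_ballP[e /= e0 He] := @filterI _ _ (nbhs_filter (0 : R)) _ _ Dpos Pn.
have e2 : 0 < e / 2 by rewrite divr_gt0.
have : ball (0 : R) e (e / 2).
  rewrite /ball /= sub0r normrN gtr0_norm// ltr_pdivrMr// ltr_pMr//; lra.
move=> /He[De Pe]; exists (e / 2); apply: Pe; first by rewrite gt_eqF.
by apply: De; exact: ltW.
Qed.

Lemma is_pdE D a f x l : coord_domain D -> D x ->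
  is_pd D a f x l -> pd D a f x = l.
Proof.
move=> Dc Dx h; have := dir_nbhs_proper a Dc Dx => ?.
exact: cvg_lim.
Qed.

Lemma is_pd_pderivable D a f x l : is_pd D a f x l -> pderivable D a f x.
Proof. by move=> h; apply/cvg_ex; exists l. Qed.

Lemma pderivableP D a f x :
  pderivable D a f x -> is_pd D a f x (pd D a f x).
Proof. by []. Qed.

Lemma dir_nbhs_cvg0 D x a : id @ dir_nbhs D x a --> (0 : R).
Proof.
move=> P P0; rewrite /= /dir_nbhs ?near_simpl near_withinE ?near_simpl.
by apply: filterS P0 => h Ph _ _.
Qed.

Lemma dir_nbhs_neq0 D x a : \forall h \near dir_nbhs D x a, h != 0.
Proof.
rewrite /dir_nbhs near_withinE ?near_simpl /=.
by apply: filterS (@filterT _ _ (nbhs_filter (0 : R))) => h _ h0 _.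
Qed.

Lemma is_pd_cvg D a f x l : is_pd D a f x l ->
  (fun h => f (x + h *: delta_mx ord0 a)) @ dir_nbhs D x a --> f x.
Proof.
move=> fl.
have : (fun h => f x + h * diff_quot f x a h) @ dir_nbhs D x a --> f x + 0 * l.
  apply: cvgD; first exact: cvg_cst.
  by apply: cvgM => //; exact: dir_nbhs_cvg0.
rewrite mul0r addr0; apply: cvg_trans; apply: near_eq_cvg.
near=> h; rewrite /diff_quot mulVKf; first by rewrite addrCA subrr addr0.
by near: h; exact: dir_nbhs_neq0.
Unshelve. all: by end_near. Qed.

End PartialDerivatives.

(** * Rules of differentiation *)

Section Rules.
Context {R : realType} {n : nat}.
Implicit Types (D W : set 'rV[R]_n) (f g : 'rV[R]_n -> R) (x y : 'rV[R]_n).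
Implicit Types (a b : 'I_n) (l m : R).

Lemma is_pd_cst D a x k : is_pd D a (fun=> k) x 0.
Proof.
rewrite /is_pd (_ : diff_quot _ _ _ = fun=> 0); first exact: cvg_cst.
by apply/funext => h; rewrite /diff_quot subrr mulr0.
Qed.

Lemma is_pdD D a f g x l m : is_pd D a f x l -> is_pd D a g x m ->
  is_pd D a (fun y => f y + g y) x (l + m).
Proof.
move=> fl gm; rewrite /is_pd.
rewrite (_ : diff_quot _ _ _ = diff_quot f x a \+ diff_quot g x a).
  exact: cvgD.
by apply/funext => h; rewrite /diff_quot /=; ring.
Qed.

Lemma is_pdN D a f x l : is_pd D a f x l ->
  is_pd D a (fun y => - f y) x (- l).
Proof.
move=> fl; rewrite /is_pd.
rewrite (_ : diff_quot _ _ _ = \- diff_quot f x a); first exact: cvgN.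
by apply/funext => h; rewrite /diff_quot /=; ring.
Qed.

Lemma is_pdB D a f g x l m : is_pd D a f x l -> is_pd D a g x m ->
  is_pd D a (fun y => f y - g y) x (l - m).
Proof. by move=> fl /is_pdN; exact: is_pdD. Qed.

Lemma is_pdM D a f g x l m : is_pd D a f x l -> is_pd D a g x m ->
  is_pd D a (fun y => f y * g y) x (l * g x + f x * m).
Proof.
move=> fl gm; rewrite /is_pd.
rewrite (_ : diff_quot _ _ _ = fun h =>
    diff_quot f x a h * g (x + h *: delta_mx ord0 a)
    + f x * diff_quot g x a h).
  apply: cvgD; first by apply: cvgM => //; exact: is_pd_cvg gm.
  by apply: cvgM => //; exact: cvg_cst.
by apply/funext => h; rewrite /diff_quot /=; ring.
Qed.

Lemma is_pdZ D a f x l k : is_pd D a f x l ->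
  is_pd D a (fun y => k * f y) x (k * l).
Proof.
by move=> /(is_pdM (is_pd_cst D a x k)); rewrite mul0r add0r.
Qed.

Lemma is_pd_eq D a f x l m : l = m -> is_pd D a f x l -> is_pd D a f x m.
Proof. by move=> ->. Qed.

Lemma is_pd_sum D a (I : Type) (r : seq I) (P : pred I)
    (f : I -> 'rV[R]_n -> R) (l : I -> R) x :
  (forall i, P i -> is_pd D a (f i) x (l i)) ->
  is_pd D a (fun y => \sum_(i <- r | P i) f i y) x (\sum_(i <- r | P i) l i).
Proof.
move=> fl; elim: r => [|i r IH].
  under [X in is_pd _ _ X]eq_fun do rewrite big_nil.
  rewrite big_nil; exact: is_pd_cst.
under [X in is_pd _ _ X]eq_fun do rewrite big_cons.
by rewrite big_cons; case: ifP => // /fl Pi; exact: is_pdD.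
Qed.

Lemma is_pd_prod D a (I : finType) (f : I -> 'rV[R]_n -> R) (l : I -> R) x :
  (forall i, is_pd D a (f i) x (l i)) ->
  is_pd D a (fun y => \prod_i f i y) x
    (\sum_i l i * \prod_(j | j != i) f j x).
Proof.
move=> fl.
suff H (r : seq I) : uniq r -> is_pd D a (fun y => \prod_(i <- r) f i y) x
    (\sum_(i <- r) l i * \prod_(j <- r | j != i) f j x).
  exact: H (index_enum_uniq I).
elim: r => [_|i r IH /= /andP[ir ur]].
  under [X in is_pd _ _ X]eq_fun do rewrite big_nil.
  rewrite big_nil; exact: is_pd_cst.
under [X in is_pd _ _ X]eq_fun do rewrite big_cons.
apply: is_pd_eq (is_pdM (fl i) (IH ur)).
rewrite big_cons big_cons eqxx /=; congr (_ * _ + _).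
  rewrite big_seq [RHS]big_seq_cond; apply: eq_bigl => j.
  by case: (boolP (j \in r)) => //= jr; apply/esym; apply: contraNneq ir => <-.
rewrite big_distrr big_seq [RHS]big_seq; apply: eq_bigr => j jr.
rewrite big_cons ifT; first by rewrite /= mulrCA.
by apply: contraNneq ir => ->.
Qed.

(** The difference quotients with small steps only see the function on the
    domain near the base point. *)
Lemma is_pd_near D W a f g x l : f x = g x ->
  (\forall y \near x, (W y <-> D y)) ->
  (\forall y \near x, D y -> f y = g y) ->
  is_pd D a f x l -> is_pd W a g x l.
Proof.
move=> fgx WD fg; apply: cvg_trans => P /=; rewrite /dir_nbhs.
rewrite !near_simpl !near_withinE !near_simpl => H.
have {}WD := @shift_cvg _ _ x a _ WD.
have {}fg := @shift_cvg _ _ x a _ fg.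
rewrite !near_simpl in WD fg.
near=> h => h0 Wh.
have Dh : D (x + h *: delta_mx ord0 a) by apply/(near WD h).
rewrite /diff_quot -fgx -(near fg h)//.
by apply: (near H h).
Unshelve. all: by end_near. Qed.

(** The limits exist for one function exactly when they exist for the other,
    so [pd] agrees even where neither function is differentiable. *)
Lemma pd_near D W a f g x : f x = g x ->
  (\forall y \near x, (W y <-> D y)) ->
  (\forall y \near x, D y -> f y = g y) ->
  pd D a f x = pd W a g x.
Proof.
move=> fgx WD fg; rewrite /pd /lim /lim_in; congr get.
apply/funext => l; apply/propext; split; first exact: is_pd_near.
apply: is_pd_near => //.
  by apply: filterS WD => y; tauto.
by near=> y => Wy; apply/esym/(near fg y) => //; apply/(near WD y).
Unshelve. all: by end_near. Qed.

(** After composition with [h] the difference quotient is that of [f] times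
    the slope of [h], extended by [h'] to coinciding points; this extension is
    continuous at [f x]. *)
Lemma is_pd_comp D a f x l (h : R -> R) (h' : R) :
  is_derive (f x) 1 h h' -> is_pd D a f x l ->
  is_pd D a (fun y => h (f y)) x (h' * l).
Proof.
move=> hd fl; have fc := is_pd_cvg fl.
pose q t := if t == f x then h' else (h t - h (f x)) / (t - f x).
have qc : q @ nbhs (f x) --> q (f x).
  have := @ex_derive _ _ _ _ _ _ _ hd => /cvgP.
  rewrite -/('D_1 h (f x)) derive_val => /cvgrPdist_lt hq.
  apply/cvgrPdist_lt => e e0; apply/(@nbhs0P R R^o).
  have := hq _ e0; rewrite near_withinE near_simpl; apply: filterS => k Hk.
  rewrite {1}/q eqxx /q -subr_eq0 [_ + k]addrC addrK.
  case: eqP => [|/eqP/Hk]; first by rewrite subrr normr0.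
  by rewrite /= [_%:A]mulr1 [_ *: _]mulrC.
rewrite /is_pd (_ : diff_quot _ _ _ = fun k =>
  q (f (x + k *: delta_mx ord0 a)) * diff_quot f x a k).
  rewrite (_ : h' = q (f x)); last by rewrite /q eqxx.
  by apply: cvgM => //; apply: cvg_comp fc qc.
apply/funext => k; rewrite /diff_quot /q; case: eqP => [->|/eqP fxk].
  by rewrite !subrr !mulr0.
by rewrite mulrCA divfK// subr_eq0.
Qed.
End Rules.

Lemma is_pd_coord (R : realType) n (D : set 'rV[R]_n) a k x :
  is_pd D a (fun y => y ord0 k) x (k == a)%:R.
Proof.
have : (fun=> (k == a)%:R : R) @ dir_nbhs D x a --> ((k == a)%:R : R).
  exact: cvg_cst.
apply: cvg_trans; apply: near_eq_cvg.
near=> h; rewrite /diff_quot !mxE eqxx /= [x _ _ + _]addrC addrK mulKf//.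
by near: h; exact: dir_nbhs_neq0.
Unshelve. all: by end_near. Qed.

(** * Derivatives of elementary functions and of matrices; the classes C^k *)

Section MoreRules.
Context {R : realType} {n : nat}.
Implicit Types (D W : set 'rV[R]_n) (f g : 'rV[R]_n -> R) (x y : 'rV[R]_n).
Implicit Types (a b : 'I_n) (l : R).

Lemma near_all (P : set 'rV[R]_n) x : (forall y, P y) -> \forall y \near x, P y.
Proof. by move=> Py; near=> y. Unshelve. all: by end_near. Qed.

Lemma within_contP D f : {within D, continuous f} <->
  forall x, D x -> f @ within D (nbhs x) --> f x.
Proof. exact: subspace_continuousP. Qed.

Lemma is_pd_eqD D a f g x l : D x -> (forall y, D y -> f y = g y) ->
  is_pd D a f x l -> is_pd D a g x l.
Proof.
by move=> Dx fg; apply: is_pd_near; [exact: fg | apply: near_all => y; split | exact: near_all].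
Qed.

Lemma pd_eqD D a f g x : D x -> (forall y, D y -> f y = g y) ->
  pd D a f x = pd D a g x.
Proof.
by move=> Dx fg; apply: pd_near; [exact: fg | apply: near_all => y; split | exact: near_all].
Qed.

Lemma is_pdV D a f x l : f x != 0 -> is_pd D a f x l ->
  is_pd D a (fun y => (f y)^-1) x (- (f x) ^- 2 * l).
Proof.
move=> fx0; apply: is_pd_comp.
apply: is_derive_eq (is_deriveV fx0 (is_derive_id _ _)) _.
exact: mulr1.
Qed.

Lemma is_pd_ln D a f x l : 0 < f x -> is_pd D a f x l ->
  is_pd D a (fun y => ln (f y)) x ((f x)^-1 * l).
Proof. by move=> fx0; apply: (is_pd_comp (h' := _) (is_derive1_ln fx0)). Qed.

Lemma is_pd_powR D a f x l s : 0 < f x -> is_pd D a f x l ->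
  is_pd D a (fun y => f y `^ s) x (s * f x `^ (s - 1) * l).
Proof. by move=> fx0; apply: (is_pd_comp (h' := _) (is_derive1_powR s fx0)). Qed.

Lemma is_pd_sqrt D a f x l : 0 < f x -> is_pd D a f x l ->
  is_pd D a (fun y => Num.sqrt (f y)) x ((2 * Num.sqrt (f x))^-1 * l).
Proof. by move=> fx0; apply: (is_pd_comp (h' := _) (is_derive1_sqrt fx0)). Qed.

(** Jacobi's formula: by the Leibniz expansion the derivative is the sum of the
    determinants in which one row has been differentiated, and each of them is
    expanded along that row. *)
Lemma is_pd_det D a m (G : 'rV[R]_n -> 'M[R]_m) (dG : 'M[R]_m) x :
  (forall i j, is_pd D a (fun y => G y i j) x (dG i j)) ->
  is_pd D a (fun y => \det (G y)) x
    (\sum_i \sum_j dG i j * cofactor (G x) i j).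
Proof.
move=> dGP.
(* The matrix whose [i]-th row has been differentiated. *)
pose M i := \matrix_(k, j) (if k == i then dG k j else G x k j).
have -> : \sum_i \sum_j dG i j * cofactor (G x) i j = \sum_i \det (M i).
  apply: eq_bigr => i _; rewrite (expand_det_row _ i); apply: eq_bigr => j _.
  rewrite !mxE eqxx; congr (_ * (_ * \det _)).
  by apply/matrixP => k k'; rewrite !mxE eq_sym (negbTE (neq_lift _ _)).
rewrite exchange_big /=.
apply: is_pd_sum => s _.
have := is_pdZ (k := (-1) ^+ s) (is_pd_prod (fun i => dGP i (s i))).
apply: is_pd_eq; rewrite big_distrr; apply: eq_bigr => i _ /=; congr (_ * _).
rewrite [RHS](bigD1 i)//= !mxE eqxx; congr (_ * _).
by apply: eq_bigr => j /negbTE ji; rewrite !mxE ji.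
Qed.

Lemma pderivable_det D a m (G : 'rV[R]_n -> 'M[R]_m) x :
  (forall i j, pderivable D a (fun y => G y i j) x) ->
  pderivable D a (fun y => \det (G y)) x.
Proof.
move=> dG; pose dM := \matrix_(i, j) pd D a (fun y => G y i j) x.
apply: (is_pd_pderivable (is_pd_det (dG := dM) _)) => i j.
by rewrite mxE; exact: dG.
Qed.

(** Cramer's rule shows that the entries of the inverse are differentiable;
    the value of the derivative then follows by differentiating [G^-1 G = 1]. *)
Lemma is_pd_invmx D a m (G : 'rV[R]_n -> 'M[R]_m) (dG : 'M[R]_m) x :
  coord_domain D -> D x -> (forall y, D y -> G y \in unitmx) ->
  (forall i j, is_pd D a (fun y => G y i j) x (dG i j)) ->
  forall i j, is_pd D a (fun y => invmx (G y) i j) x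
    ((- (invmx (G x) *m dG *m invmx (G x))) i j).
Proof.
move=> Dc Dx Gu dGP.
have Pd i j : pderivable D a (fun y => invmx (G y) i j) x.
  have det0 : \det (G x) != 0 by have := Gu _ Dx; rewrite unitmxE unitfE.
  apply: is_pd_pderivable; apply: (@is_pd_eqD D a
    (fun y => (\det (G y))^-1 * ((-1) ^+ (j + i) *
      \det (row' j (col' i (G y)))))) => //.
    by move=> y Dy; rewrite /invmx (Gu _ Dy) !mxE.
  apply: is_pdM (is_pdV det0 (is_pd_det dGP)) _.
  apply: is_pdZ; apply: pderivable_det => k k'.
  apply: is_pd_pderivable; under [X in is_pd _ _ X]eq_fun do rewrite !mxE.
  exact: dGP.
pose dP := \matrix_(i, j) pd D a (fun y => invmx (G y) i j) x.
suff <- : dP = - (invmx (G x) *m dG *m invmx (G x)).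
  by move=> i j; rewrite mxE; exact: Pd.
have : dP *m G x + invmx (G x) *m dG = 0.
  apply/matrixP => i j; rewrite !mxE -big_split/=.
  rewrite -[RHS](is_pdE Dc Dx (is_pd_cst D a x ((1%:M : 'M[R]_m) i j))).
  apply/esym/(is_pdE Dc Dx).
  apply: (@is_pd_eqD D a (fun y => \sum_k invmx (G y) i k * G y k j)) => //.
    by move=> y Dy; rewrite -(mulVmx (Gu _ Dy)) mxE.
  apply: is_pd_sum => k _; rewrite mxE; apply: is_pdM; [exact: Pd|exact: dGP].
move/(congr1 (fun A => A *m invmx (G x))); rewrite mulmxDl mul0mx.
by rewrite mulmxK ?Gu// => /eqP; rewrite addr_eq0 => /eqP.
Qed.

Definition relopen W D : Prop :=
  W `<=` D /\ forall x, W x -> \forall y \near x, D y -> W y.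

Lemma relopen_near W D x : relopen W D -> W x ->
  \forall y \near x, (W y <-> D y).
Proof.
by move=> [WD WDn] /WDn; apply: filterS => y ?; split=> // /WD.
Qed.

Lemma coord_domain_relopen W D : relopen W D -> coord_domain D ->
  coord_domain W.
Proof.
move=> WD Dc x Wx; have DWn := relopen_near WD Wx.
case: (Dc x (WD.1 _ Wx)) => [Dn|[xb Dn]]; [left|right; split=> //].
  by apply: filterS2 Dn DWn => y Dy [_]; exact.
by apply: filterS2 Dn DWn => y; tauto.
Qed.

Lemma is_pd_relopen W D a f x l : relopen W D -> W x ->
  is_pd D a f x l <-> is_pd W a f x l.
Proof.
move=> WD Wx; split; apply: is_pd_near => //; try exact: near_all.
  exact: relopen_near.
by apply: filterS (relopen_near WD Wx) => y; tauto.
Qed.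

Lemma pd_relopen W D a f x : relopen W D -> W x ->
  pd D a f x = pd W a f x.
Proof.
by move=> WD Wx; apply: pd_near => //; [exact: relopen_near | exact: near_all].
Qed.

(** By induction on [k]: the partial derivatives within [W] are on [W] those
    within [D], and depend only on the values on [W]. *)
Lemma Ck_with_near P k W D f g : relopen W D ->
  (forall y, W y -> f y = g y) -> Ck_with P k D f -> Ck k W g.
Proof.
move=> WD; have [WD1 _] := WD.
have cont f' g' : (forall y, W y -> f' y = g' y) ->
    {within D, continuous f'} -> {within W, continuous g'}.
  move=> fg /within_contP fc; apply/within_contP => x Wx.
  rewrite -(fg _ Wx).
  have : f' @ within W (nbhs x) --> f' x.
    apply: cvg_trans (fc x (WD1 _ Wx)); apply: cvg_app.
    exact: within_subset.
  apply: cvg_trans; apply: near_eq_cvg; rewrite near_withinE.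
  exact: near_all => y Wy; exact: fg.
elim: k f g => [|k IH] f g fg [fc fP]; split; try exact: cont fc; first by [].
case: fP => fd fC; split => a.
  move=> x Wx; have := pderivableP (fd a x (WD1 _ Wx)).
  move/(is_pd_relopen a f (pd D a f x) WD Wx)/(is_pd_eqD Wx fg).
  exact: is_pd_pderivable.
apply: IH (fC a) => y Wy; rewrite (pd_relopen a f WD Wy).
exact: pd_eqD.
Qed.

Lemma relopen_refl D : relopen D D.
Proof. by split=> // x _; exact: near_all. Qed.

Lemma Ck_eqD k D f g : (forall y, D y -> f y = g y) -> Ck k D f -> Ck k D g.
Proof. by move=> fg; apply: Ck_with_near => //; exact: relopen_refl. Qed.

Lemma Ck_relopen k W D f : relopen W D -> Ck k D f -> Ck k W f.
Proof. by move=> WD; exact: Ck_with_near. Qed.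

Lemma Ck_withW P j k D f : (j <= k)%N -> Ck_with P k D f -> Ck j D f.
Proof.
elim: k j f => [|k IH] [|j] f //=; try by move=> _ [].
by move=> jk [fc [fd fC]]; split=> //; split=> // a; exact: IH.
Qed.

Lemma Ck_cont k D f : Ck k D f -> {within D, continuous f}.
Proof. by case: k => [|k] []. Qed.

Lemma Ck_pderivable k D f a x : Ck k.+1 D f -> D x -> pderivable D a f x.
Proof. by move=> [_ [fd _]]; exact: fd. Qed.

Lemma Ck_pd k D f a : Ck k.+1 D f -> Ck k D (pd D a f).
Proof. by move=> [_ [_ fC]]; exact: fC. Qed.

Lemma CkS k D f : Ck k.+1 D f -> Ck k D f.
Proof. exact: Ck_withW. Qed.

Lemma Ck_cst k D v : coord_domain D -> Ck k D (fun=> v).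
Proof.
move=> Dc; elim: k v => [|k IH] v; split=> //; try by apply/within_contP => x _; exact: cvg_cst.
split=> a.
  by move=> x Dx; apply: is_pd_pderivable; exact: is_pd_cst.
apply: Ck_eqD (IH 0) => y Dy; apply/esym/(is_pdE Dc Dy); exact: is_pd_cst.
Qed.

Lemma CkD k D f g : coord_domain D -> Ck k D f -> Ck k D g ->
  Ck k D (fun y => f y + g y).
Proof.
move=> Dc.
have cont f' g' : {within D, continuous f'} -> {within D, continuous g'} ->
    {within D, continuous (fun y => f' y + g' y)}.
  move=> /within_contP fc /within_contP gc.
  by apply/within_contP => x Dx; exact: cvgD (fc x Dx) (gc x Dx).
elim: k f g => [|k IH] f g [fc fP] [gc gP]; split; try exact: cont; first by [].
case: fP gP => [fd fC] [gd gC]; split=> a.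
  move=> x Dx; apply: is_pd_pderivable.
  by apply: is_pdD; [exact: fd | exact: gd].
apply: Ck_eqD (IH _ _ (fC a) (gC a)) => y Dy; apply/esym/(is_pdE Dc Dy).
by apply: is_pdD; [exact: fd | exact: gd].
Qed.

Lemma CkM k D f g : coord_domain D -> Ck k D f -> Ck k D g ->
  Ck k D (fun y => f y * g y).
Proof.
move=> Dc.
have cont f' g' : {within D, continuous f'} -> {within D, continuous g'} ->
    {within D, continuous (fun y => f' y * g' y)}.
  move=> /within_contP fc /within_contP gc.
  by apply/within_contP => x Dx; exact: cvgM (fc x Dx) (gc x Dx).
elim: k f g => [|k IH] f g fC gC.
  by split=> //; apply: cont; [exact: Ck_cont fC | exact: Ck_cont gC].
split; first by apply: cont; [exact: Ck_cont fC | exact: Ck_cont gC].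
split=> a.
  move=> x Dx; apply: is_pd_pderivable.
  by apply: is_pdM; [exact: Ck_pderivable fC Dx | exact: Ck_pderivable gC Dx].
have := CkD Dc (IH _ _ (Ck_pd a fC) (CkS gC)) (IH _ _ (CkS fC) (Ck_pd a gC)).
apply: Ck_eqD => y Dy; apply/esym/(is_pdE Dc Dy).
by apply: is_pdM; [exact: Ck_pderivable fC Dy | exact: Ck_pderivable gC Dy].
Qed.

(** The derivative of [f `^ s] involves the exponent [s - 1], which is why the
    induction on [k] is for all exponents at once. *)
Lemma Ck_powR k D f s : coord_domain D -> (forall y, D y -> 0 < f y) ->
  Ck k D f -> Ck k D (fun y => f y `^ s).
Proof.
move=> Dc f0.
have cont : forall t, {within D, continuous f} ->
    {within D, continuous (fun y => f y `^ t)}.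
  move=> t /within_contP fc; apply/within_contP => x Dx.
  have tc : {for f x, continuous (fun u : R => u `^ t)}; last first.
    exact: (cvg_comp f (fun u => u `^ t) (fc x Dx) tc).
  apply: differentiable_continuous; apply/derivable1_diffP.
  by apply: ex_derive; exact: is_derive1_powR (f0 _ Dx).
elim: k s => [|k IH] s fC; first by split=> //; apply: cont; exact: Ck_cont fC.
split; first by apply: cont; exact: Ck_cont fC.
split=> a.
  move=> x Dx; apply: is_pd_pderivable; apply: is_pd_powR (f0 _ Dx) _.
  exact: Ck_pderivable fC Dx.
have := CkM Dc (CkM Dc (Ck_cst k s Dc) (IH (s - 1) (CkS fC))) (Ck_pd a fC).
apply: Ck_eqD => y Dy; apply/esym/(is_pdE Dc Dy).
apply: is_pd_powR (f0 _ Dy) _; exact: Ck_pderivable fC Dy.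
Qed.

End MoreRules.

(** * The chain rule on domains with boundary *)

Section ChainRule.
Context {R : realType} {n : nat}.
Implicit Types (D : set 'rV[R]_n) (f : 'rV[R]_n -> R) (x y z u : 'rV[R]_n).

Lemma row_ballP x y (e : R) : 0 < e ->
  ball x e y <-> forall k, `|x ord0 k - y ord0 k| < e.
Proof.
move=> e0; split; first by move=> [_ xy] k; exact: xy.
by move=> xy; split=> // i j; rewrite [i]ord1; exact: xy.
Qed.

(** The path from [x] to [z] that changes the coordinates in order visits the
    points [splice 0 x z = x], ..., [splice n x z = z]. *)
Definition splice (k : nat) x z : 'rV[R]_n :=
  \row_j (if (j < k)%N then z ord0 j else x ord0 j).

(** The increment of [f] along the [k]-th step of this path, divided by the
    length of the step.  The value at a degenerate step makes it continuous at
    [z = x]. *)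
Definition slope D f x (k : 'I_n) z : R :=
  if z ord0 k == x ord0 k then pd D k f x
  else (f (splice k.+1 x z) - f (splice k x z)) / (z ord0 k - x ord0 k).

Definition coord_line (k : 'I_n) x z (t : R) : 'rV[R]_n :=
  splice k x z + (t - x ord0 k) *: delta_mx ord0 k.

Lemma coord_lineE k x z t j : coord_line k x z t ord0 j =
  if j == k then t else if (j < k)%N then z ord0 j else x ord0 j.
Proof.
rewrite !mxE eqxx /=; case: eqVneq => [->|_]; last by rewrite mulr0 addr0.
by rewrite ltnn mulr1 addrC subrK.
Qed.

Lemma coord_line0 k x z : coord_line k x z (x ord0 k) = splice k x z.
Proof. by rewrite /coord_line subrr scale0r addr0. Qed.

Lemma coord_line1 k x z : coord_line k x z (z ord0 k) = splice k.+1 x z.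
Proof.
apply/rowP => j; rewrite coord_lineE !mxE ltnS.
have [->|/negbTE jk] := eqVneq j k; first by rewrite leqnn.
by rewrite -val_eqE /= in jk; rewrite [(j <= k)%N]leq_eqVlt jk.
Qed.

Lemma coord_lineD k x z t h :
  coord_line k x z (t + h) = coord_line k x z t + h *: delta_mx ord0 k.
Proof.
by rewrite /coord_line -[RHS]addrA -scalerDl; congr (_ + _ *: _); ring.
Qed.

Lemma slope_sum D f x z :
  f z - f x = \sum_k slope D f x k z * (z ord0 k - x ord0 k).
Proof.
have -> : f z - f x = \sum_(k < n) (f (splice k.+1 x z) - f (splice k x z)).
  rewrite -(big_mkord xpredT (fun k => f (splice k.+1 x z) - f (splice k x z))).
  rewrite telescope_sumr//; congr (f _ - f _).
    by apply/rowP => j; rewrite mxE ltn_ord.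
  by apply/rowP => j; rewrite mxE.
apply: eq_bigr => k _; rewrite /slope; case: eqP => [zx|/eqP zx].
  by rewrite -coord_line0 -coord_line1 zx !subrr mulr0.
by rewrite divfK// subr_eq0.
Qed.

(** Mean value theorem along one step of the path.  The path stays in the box
    around [x], and also in the half space, since each coordinate of a point of it
    lies between those of [x] and [z]; strictly inside a step the derivative in the moving
    direction is two-sided, even in the normal direction. *)
Lemma slope_pd D f x k z (e : R) : 0 < e ->
  coord_domain D -> Ck 1 D f -> D x -> D z ->
  (forall u, ball x e u -> D u) \/
  (half_space_bdry x /\ forall u, ball x e u -> (D u <-> half_space u)) ->
  ball x e z ->
  exists u, [/\ D u, ball x e u & slope D f x k z = pd D k f u].
Proof.
move=> e0 Dc fC Dx Dz box; rewrite (row_ballP _ _ e0) => xz.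
rewrite /slope; case: eqP => [_|/eqP zx].
  by exists x; split=> //; exact: ballxx.
have line t : Num.min (x ord0 k) (z ord0 k) <= t <= Num.max (x ord0 k) (z ord0 k) ->
    D (coord_line k x z t) /\ ball x e (coord_line k x z t).
  move=> tI.
  have B : ball x e (coord_line k x z t).
    apply/(row_ballP _ _ e0) => j; rewrite coord_lineE.
    case: eqVneq => [->|_].
      apply: le_lt_trans (xz k).
      move: tI; rewrite ge_min le_max => /andP[/orP[h1|h1] /orP[h2|h2]];
        rewrite ler_norml; apply/andP; split;
        move: (ler_norm (x ord0 k - z ord0 k));
        move: (ler_norm (- (x ord0 k - z ord0 k))); rewrite normrN; lra.
    case: ifP => _; first exact: xz.
    by rewrite subrr normr0; apply: le_lt_trans (xz k).
  split=> //; case: box => [|[xb DH]]; first exact.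
  have zH : half_space z by apply/DH => //; apply/(row_ballP _ _ e0).
  apply/DH => // j jn; rewrite coord_lineE; case: eqVneq => [jk|_].
    move: tI => /andP[+ _]; apply: le_trans.
    by rewrite le_min -jk zH// xb// lexx.
  by case: ifP => _; [exact: zH | rewrite xb].
pose g t := f (coord_line k x z t).
have gd t :
    t \in `]Num.min (x ord0 k) (z ord0 k), Num.max (x ord0 k) (z ord0 k)[ ->
    is_derive t 1 g (pd D k f (coord_line k x z t)).
  rewrite in_itv /= => tI.
  have [Dt _] : D (coord_line k x z t) /\ ball x e (coord_line k x z t).
    by apply: line; case/andP: tI => /ltW -> /ltW ->.
  have H : (fun h => h^-1 *: ((g \o shift t) (h *: 1) - g t)) @ 0^' -->
      pd D k f (coord_line k x z t).
    have := pderivableP (Ck_pderivable (a := k) fC Dt).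
    rewrite /is_pd (_ : (fun h => h^-1 *: _) = diff_quot f (coord_line k x z t) k).
      apply: cvg_trans; apply: cvg_app.
      move=> P H.
      have {}H : \forall h \near (0 : R)^',
        D (coord_line k x z t + h *: delta_mx ord0 k) -> P h := H.
      (* Small steps from [t] stay inside the segment, so the derivative at
         [t] is two-sided. *)
      have tn : \forall h \near (0 : R), t + h \in
          `]Num.min (x ord0 k) (z ord0 k), Num.max (x ord0 k) (z ord0 k)[.
        have tin : t \in `]Num.min (x ord0 k) (z ord0 k), Num.max (x ord0 k) (z ord0 k)[.
          by rewrite in_itv.
        by have /(@nbhs0P R R^o) := near_in_itvoo tin.
      rewrite near_withinE in H.
      suff: \forall h \near (0 : R)^', P h by []. rewrite near_withinE.
      near=> h => h0; apply: (near H h) => //.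
      rewrite -coord_lineD; apply: (line _ _).1.
      have : t + h \in `]Num.min (x ord0 k) (z ord0 k),
                        Num.max (x ord0 k) (z ord0 k)[ by apply: (near tn h).
      by rewrite in_itv /= => /andP[/ltW-> /ltW->].
    apply/funext => h; rewrite /diff_quot /g /= -coord_lineD.
    by rewrite [h%:A]mulr1 [h + t]addrC.
  by split; [apply/cvg_ex; eexists; exact: H | exact: cvg_lim H].
have gc : {within
    `[Num.min (x ord0 k) (z ord0 k), Num.max (x ord0 k) (z ord0 k)],
    continuous g}.
  set A := [set` _]; have AI t : A t ->
      Num.min (x ord0 k) (z ord0 k) <= t <= Num.max (x ord0 k) (z ord0 k).
    by rewrite /A /= in_itv.
  apply/subspace_continuousP => t At.
  have [Dt _] := line t (AI t At).
  have /within_contP/(_ _ Dt) fcc := Ck_cont fC.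
  rewrite /from_subspace /g; apply: cvg_trans fcc => P H.
  have {}H : \forall u \near coord_line k x z t, D u -> P (f u) := H.
  have lc : coord_line k x z @ t --> coord_line k x z t.
    by apply: cvgD; [exact: cvg_cst | apply: cvgZr_tmp; apply: cvgB;
      [exact: cvg_id | exact: cvg_cst]].
  have {}H : \forall s \near t,
    D (coord_line k x z s) -> P (f (coord_line k x z s)) := lc _ H.
  suff : \forall s \near t, A s -> P (f (coord_line k x z s)) by [].
  near=> s => As; apply: (near H s) => //.
  by apply: (line _ (AI s As)).1.
(* The step may go in either direction, and [MVT] wants ordered endpoints. *)
have [xz'|zx'] := ltP (x ord0 k) (z ord0 k).
  have Emin : Num.min (x ord0 k) (z ord0 k) = x ord0 k by rewrite min_l// ltW.
  have Emax : Num.max (x ord0 k) (z ord0 k) = z ord0 k by rewrite max_r// ltW.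
  rewrite Emin Emax in line gd gc.
  have [c cI gE] := MVT xz' gd gc.
  have [|Dcl Bc] := line c.
    by move: cI; rewrite in_itv /= => /andP[/ltW-> /ltW->].
  exists (coord_line k x z c); split=> //.
  rewrite -coord_line0 -coord_line1.
  by apply: (canLR (mulfK _)); [rewrite subr_eq0 | exact: gE].
have {}zx' : z ord0 k < x ord0 k by rewrite lt_neqAle zx.
have Emin : Num.min (x ord0 k) (z ord0 k) = z ord0 k by rewrite min_r// ltW.
have Emax : Num.max (x ord0 k) (z ord0 k) = x ord0 k by rewrite max_l// ltW.
rewrite Emin Emax in line gd gc.
have [c cI gE] := MVT zx' gd gc.
have [|Dcl Bc] := line c.
  by move: cI; rewrite in_itv /= => /andP[/ltW-> /ltW->].
exists (coord_line k x z c); split=> //.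
rewrite -coord_line0 -coord_line1 -opprB -[X in _ / X]opprB invrN mulrNN.
by apply: (canLR (mulfK _)); [rewrite subr_eq0 gt_eqF | exact: gE].
Unshelve. all: by end_near. Qed.

End ChainRule.

Section MultivariateChainRule.
Context {R : realType}.

(** A box small enough for [P] in which the domain is either everything or the
    half space. *)
Lemma coord_domain_box n (D : set 'rV[R]_n) x (P : set 'rV[R]_n) :
  coord_domain D -> D x -> (\forall u \near x, P u) ->
  exists2 e : R, 0 < e &
    [/\ forall u, ball x e u -> P u &
      (forall u, ball x e u -> D u) \/
      (half_space_bdry x /\ forall u, ball x e u -> (D u <-> half_space u))].
Proof.
move=> Dc Dx Px; case: (Dc x Dx) => [Dn|[xb Dn]].
  have /nbhs_ballP[e /= e0 He] := @filterI _ _ (nbhs_filter x) _ _ Px Dn.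
  exists e => //; split; first by move=> u /He[].
  by left=> u /He[].
have /nbhs_ballP[e /= e0 He] := @filterI _ _ (nbhs_filter x) _ _ Px Dn.
exists e => //; split; first by move=> u /He[].
by right; split=> // u /He[].
Qed.

(** The slope is a value of the partial derivative at a point between [x] and
    [z], so this is the continuity of that partial derivative. *)
Lemma slope_cvg n (D : set 'rV[R]_n) f x k :
  coord_domain D -> Ck 1 D f -> D x ->
  slope D f x k @ within D (nbhs x) --> pd D k f x.
Proof.
move=> Dc fC Dx; apply/cvgrPdist_lt => e e0.
have /within_contP/(_ _ Dx)/cvgrPdist_lt/(_ _ e0) := Ck_cont (Ck_pd k fC).
rewrite near_withinE near_simpl => Pn.
have [d d0 [HP box]] := coord_domain_box Dc Dx Pn.
rewrite near_withinE near_simpl.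
apply: filterS (nbhsx_ballx x d d0) => z xz Dz.
have [u [Du xu ->]] := slope_pd k d0 Dc fC Dx Dz box xz.
exact: HP.
Qed.

(** The increment of [f] is the sum of its slopes times the increments of the
    coordinates ([slope_sum]); dividing by the step [h] expresses the difference
    quotient of the composition exactly through those of the components of
    [phi], and all factors converge. *)
Lemma is_pd_chain n m (D : set 'rV[R]_n) (E : set 'rV[R]_m)
    (phi : 'rV[R]_n -> 'rV[R]_m) (dphi : 'I_m -> R) f a x :
  coord_domain E -> (forall y, D y -> E (phi y)) -> D x -> Ck 1 E f ->
  (forall k, is_pd D a (fun y => phi y ord0 k) x (dphi k)) ->
  is_pd D a (fun y => f (phi y)) x (\sum_k pd E k f (phi x) * dphi k).
Proof.
move=> Ec DE Dx fC dphiP.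
rewrite /is_pd; pose F := dir_nbhs D x a.
have phic : (fun h => phi (x + h *: delta_mx ord0 a)) @ F -->
    within E (nbhs (phi x)).
  move=> P Pn.
  have {}Pn : \forall u \near phi x, E u -> P u := Pn.
  suff : \forall h \near F, P (phi (x + h *: delta_mx ord0 a)) by [].
  have /nbhs_ballP[e /= e0 He] := Pn.
  have FD : \forall h \near F, D (x + h *: delta_mx ord0 a).
    by rewrite /F /dir_nbhs near_withinE; near=> h.
  have Fk k : \forall h \near F, `|phi x ord0 k
      - phi (x + h *: delta_mx ord0 a) ord0 k| < e.
    by have /cvgrPdist_lt/(_ _ e0) := is_pd_cvg (dphiP k).
  have {}Fk : \forall h \near F, forall k, `|phi x ord0 k
      - phi (x + h *: delta_mx ord0 a) ord0 k| < e.
    exact: filter_forall.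
  near=> h; apply: He.
    by apply/row_ballP => //; apply: (near Fk h).
  by apply: DE; apply: (near FD h).
rewrite (_ : diff_quot _ _ _ = fun h => \sum_k
    slope E f (phi x) k (phi (x + h *: delta_mx ord0 a)) *
    diff_quot (fun y => phi y ord0 k) x a h).
  apply: (cvg_big (op := +%R)) => [|k _]; first exact: add_continuous.
  apply: cvgM; last exact: dphiP.
  exact: cvg_comp phic (slope_cvg (k := k) Ec fC (DE _ Dx)).
apply/funext => h; rewrite /diff_quot (slope_sum E) mulr_sumr.
by apply: eq_bigr => k _; rewrite mulrCA.
Unshelve. all: by end_near. Qed.

End MultivariateChainRule.

(** * Algebra of the conformal difference tensor *)

Section IndexAlgebra.
Context {R : realFieldType} {n : nat}.
Implicit Types (a b c d : 'I_n).

Lemma sum_deltar (F : 'I_n -> R) j : \sum_i F i * (i == j)%:R = F j.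
Proof.
rewrite (bigD1 j)//= eqxx mulr1 big1 ?addr0// => i /negbTE ->.
by rewrite mulr0.
Qed.

Lemma sum_deltal (F : 'I_n -> R) j : \sum_i F i * (j == i)%:R = F j.
Proof. by under eq_bigr do rewrite eq_sym; exact: sum_deltar. Qed.

Variables (g P : 'M[R]_n).
Hypotheses (gT : g^T = g) (PT : P^T = P) (Pg : P *m g = 1%:M).

Let gC a b : g a b = g b a. Proof. by rewrite -{1}gT mxE. Qed.
Let PC a b : P a b = P b a. Proof. by rewrite -{1}PT mxE. Qed.
Let PgE a b : \sum_c P a c * g c b = (a == b)%:R.
Proof. by have := congr1 (fun A : 'M[R]_n => A a b) Pg; rewrite !mxE. Qed.

Variable phi : 'I_n -> R.

Definition raise (v : 'I_n -> R) c : R := \sum_d P c d * v d.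

Lemma lower_raise v a : \sum_c g a c * raise v c = v a.
Proof.
under eq_bigr do rewrite mulr_sumr.
rewrite exchange_big /= -[RHS](sum_deltar v); apply: eq_bigr => d _.
rewrite -PgE mulr_sumr; apply: eq_bigr => c _.
by rewrite [P d c]PC [g a c]gC; ring.
Qed.

Lemma sum_raise v w : \sum_c v c * raise w c = \sum_c raise v c * w c.
Proof.
rewrite /raise; under eq_bigr do rewrite mulr_sumr.
rewrite exchange_big; apply: eq_bigr => c _ /=.
by rewrite mulr_suml; apply: eq_bigr => d _; rewrite [P d c]PC; ring.
Qed.

Lemma trace_Pg : \sum_a \sum_b P a b * g a b = n%:R.
Proof.
transitivity (\sum_(a < n) (1 : R)); last by rewrite sumr_const card_ord.
apply: eq_bigr => a _; transitivity ((a == a)%:R : R); last by rewrite eqxx.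
by rewrite -PgE; apply: eq_bigr => b _; rewrite gC.
Qed.

(** The difference of the Christoffel symbols of [c g] and [g], when [phi] is
    the differential of [ln c]. *)
Definition conf_diff c a b : R :=
  2^-1 * (phi a * (c == b)%:R + phi b * (c == a)%:R - g a b * raise phi c).

Lemma conf_diffC c a b : conf_diff c a b = conf_diff c b a.
Proof. by rewrite /conf_diff gC; ring. Qed.

Lemma conf_diff_trace a : \sum_c conf_diff c a c = n%:R / 2 * phi a.
Proof.
rewrite -mulr_sumr sumrB big_split /= lower_raise sum_deltar.
under eq_bigr do rewrite eqxx mulr1.
by rewrite sumr_const card_ord -mulr_natr; field.
Qed.

Lemma conf_diff_contract d :
  \sum_a \sum_b P a b * conf_diff d a b = (2 - n%:R) / 2 * raise phi d.
Proof.
transitivity (2^-1 * (\sum_a \sum_b P a b * phi a * (d == b)%:R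
  + \sum_a \sum_b P a b * phi b * (d == a)%:R
  - (\sum_a \sum_b P a b * g a b) * raise phi d)).
  rewrite mulr_suml -big_split -sumrB mulr_sumr; apply: eq_bigr => a _ /=.
  rewrite mulr_suml -big_split -sumrB mulr_sumr; apply: eq_bigr => b _ /=.
  by rewrite /conf_diff; ring.
rewrite trace_Pg.
under eq_bigr do rewrite sum_deltal.
rewrite [X in _ + X - _]exchange_big /=.
under [X in _ + X - _]eq_bigr do rewrite sum_deltal.
rewrite (_ : \sum_i P i d * phi i = raise phi d).
  by rewrite -/(raise phi d); field.
by apply: eq_bigr => i _; rewrite PC.
Qed.

(** Of the three terms of [conf_diff], the first and the third contribute the
    same multiple of the trace of [A] and cancel. *)
Lemma conf_diff_cross (A : 'I_n -> 'I_n -> 'I_n -> R) :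
  (forall c a b, A c a b = A c b a) ->
  \sum_a \sum_b P a b * (\sum_c \sum_d A c b d * conf_diff d a c)
  = 2^-1 * \sum_d (\sum_a \sum_b P a b * A d a b) * phi d.
Proof.
move=> AC.
pose t b := \sum_c A c b c.
have H1 : \sum_a \sum_b P a b * (\sum_c \sum_d A c b d * (phi a * (d == c)%:R))
    = \sum_b t b * raise phi b.
  rewrite exchange_big; apply: eq_bigr => b _ /=.
  rewrite mulr_sumr; apply: eq_bigr => a _.
  rewrite [P b a]PC mulrCA; congr (_ * _).
  rewrite mulr_suml; apply: eq_bigr => c _.
  by under eq_bigr do rewrite mulrA; rewrite sum_deltar.
have H2 : \sum_a \sum_b P a b * (\sum_c \sum_d A c b d * (phi c * (d == a)%:R))
    = \sum_d (\sum_a \sum_b P a b * A d a b) * phi d.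
  under [RHS]eq_bigr do rewrite mulr_suml.
  rewrite [RHS]exchange_big; apply: eq_bigr => a _ /=.
  under [RHS]eq_bigr do rewrite mulr_suml.
  rewrite [RHS]exchange_big; apply: eq_bigr => b _ /=.
  rewrite mulr_sumr; apply: eq_bigr => c _.
  by under eq_bigr do rewrite mulrA; rewrite sum_deltar [A c b a]AC mulrA.
have H3 : \sum_a \sum_b P a b *
      (\sum_c \sum_d A c b d * (g a c * raise phi d))
    = \sum_b t b * raise phi b.
  transitivity (\sum_b \sum_c \sum_d (\sum_a P b a * g a c) *
      (A c b d * raise phi d)).
    rewrite exchange_big; apply: eq_bigr => b _ /=.
    under eq_bigr do rewrite mulr_sumr.
    rewrite exchange_big; apply: eq_bigr => c _ /=.
    under eq_bigr do rewrite mulr_sumr.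
    rewrite exchange_big; apply: eq_bigr => d _ /=.
    rewrite mulr_suml; apply: eq_bigr => a _.
    by rewrite PC; ring.
  under eq_bigr => b _.
    under eq_bigr => c _.
      under eq_bigr do rewrite PgE mulrC.
      rewrite -mulr_suml.
      over.
    rewrite sum_deltal.
    over.
  rewrite exchange_big; apply: eq_bigr => d _ /=.
  by rewrite -mulr_suml; congr (_ * _); apply: eq_bigr => c _; rewrite AC.
rewrite -H2; set s2 := (X in _ = _ * X).
transitivity (2^-1 * (\sum_b t b * raise phi b + s2 - \sum_b t b * raise phi b));
  last by rewrite addrC addKr.
rewrite -{1}H1 -H3 /s2.
rewrite -big_split -sumrB mulr_sumr; apply: eq_bigr => a _ /=.
rewrite -big_split -sumrB mulr_sumr; apply: eq_bigr => b _ /=.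
rewrite -mulrDr -mulrBr mulrCA; congr (_ * _).
rewrite -big_split -sumrB mulr_sumr; apply: eq_bigr => c _ /=.
rewrite -big_split -sumrB mulr_sumr; apply: eq_bigr => d _ /=.
by rewrite /conf_diff; ring.
Qed.

End IndexAlgebra.

(** * The trace of the change of the Ricci tensor *)

Section CurvatureAlgebra.
Context {R : realFieldType} {n : nat}.
Implicit Types (a b c d : 'I_n).
Variables (g P : 'M[R]_n).
Hypotheses (gT : g^T = g) (PT : P^T = P) (Pg : P *m g = 1%:M).
(* The letters [dg d a b], [h a b] and [u a c] stand for the derivatives
   [d_d g_ab], [d_a phi_b] and [d_a phi^c]; [hE] is then the derivative of
   [phi_b = g_bc phi^c]. *)
Variables (phi : 'I_n -> R) (dg : 'I_n -> 'I_n -> 'I_n -> R).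
Hypothesis dgC : forall d a b, dg d a b = dg d b a.
Variables (h u : 'I_n -> 'I_n -> R).
Hypothesis hE : forall a b,
  h a b = \sum_c (dg a b c * raise P phi c + g b c * u a c).

Let gC a b : g a b = g b a. Proof. by rewrite -{1}gT mxE. Qed.
Let PC a b : P a b = P b a. Proof. by rewrite -{1}PT mxE. Qed.

(* The Christoffel symbols [Gam], their two contractions, and the derivatives of
   the conformal difference tensor. *)
Let T := conf_diff g P phi.
Let Gam c a b : R :=
  2^-1 * \sum_d P c d * (dg a b d + dg b a d - dg d a b).
Let gam c := \sum_d Gam d d c.
Let GamP d := \sum_a \sum_b P a b * Gam d a b.
Let dT d c a b : R := 2^-1 * (h d a * (c == b)%:R + h d b * (c == a)%:R
  - (dg d a b * raise P phi c + g a b * u d c)).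

Let GamC c a b : Gam c a b = Gam c b a.
Proof.
by congr (_ * _); apply: eq_bigr => d _; rewrite [dg d a b]dgC; ring.
Qed.

(** The two other terms of the Christoffel symbol are exchanged by the symmetry
    of [P], and cancel. *)
Lemma christoffel_trace c :
  gam c = 2^-1 * \sum_a \sum_b P a b * dg c a b.
Proof.
rewrite /gam /Gam -mulr_sumr; congr (_ * _).
transitivity (\sum_a \sum_b P a b * dg c a b
  + (\sum_a \sum_b P a b * dg a b c - \sum_a \sum_b P a b * dg b a c)).
  rewrite -sumrB -big_split; apply: eq_bigr => a _ /=.
  rewrite -sumrB -big_split; apply: eq_bigr => b _ /=.
  by rewrite [dg a c b]dgC; ring.
rewrite [X in _ + (X - _)]exchange_big /=.
rewrite (_ : \sum_j \sum_i P i j * dg i j c = \sum_a \sum_b P a b * dg b a c).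
  by rewrite subrr addr0.
by apply: eq_bigr => a _; apply: eq_bigr => b _; rewrite PC.
Qed.

Let lowered c a b : \sum_d g c d * Gam d a b =
  2^-1 * (dg a b c + dg b a c - dg c a b).
Proof.
rewrite -(lower_raise gT PT Pg
  (fun d => 2^-1 * (dg a b d + dg b a d - dg d a b)) c).
apply: eq_bigr => d _; congr (_ * _); rewrite /Gam /raise mulr_sumr.
by apply: eq_bigr => e _; rewrite mulrCA.
Qed.

Let dg_contract :
  \sum_a \sum_b P a b * \sum_c dg a b c * raise P phi c =
  \sum_d GamP d * phi d + \sum_c gam c * raise P phi c.
Proof.
have HG : \sum_d GamP d * phi d =
    \sum_c (\sum_a \sum_b P a b * (\sum_d g c d * Gam d a b)) * raise P phi c.
  transitivity (\sum_d GamP d * (\sum_c g d c * raise P phi c)).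
    by apply: eq_bigr => d _; rewrite (lower_raise gT PT Pg).
  under eq_bigr do rewrite mulr_sumr.
  rewrite exchange_big; apply: eq_bigr => c _ /=.
  under eq_bigr do rewrite mulrA.
  rewrite -mulr_suml; congr (_ * _).
  under [LHS]eq_bigr do rewrite /GamP mulr_suml.
  rewrite exchange_big; apply: eq_bigr => a _ /=.
  under eq_bigr do rewrite mulr_suml.
  rewrite exchange_big; apply: eq_bigr => b _ /=.
  by rewrite mulr_sumr; apply: eq_bigr => d _; rewrite [g c d]gC; ring.
rewrite HG -big_split /=.
transitivity (\sum_c (\sum_a \sum_b P a b * dg a b c) * raise P phi c).
  under [RHS]eq_bigr do rewrite mulr_suml.
  rewrite [RHS]exchange_big; apply: eq_bigr => a _ /=.
  under [RHS]eq_bigr do rewrite mulr_suml.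
  rewrite [RHS]exchange_big; apply: eq_bigr => b _ /=.
  by rewrite mulr_sumr; apply: eq_bigr => c _; rewrite mulrA.
apply: eq_bigr => c _; rewrite -mulrDl; congr (_ * _).
rewrite christoffel_trace.
have E : \sum_a \sum_b P a b * dg a b c = \sum_a \sum_b P a b * dg b a c.
  rewrite exchange_big; apply: eq_bigr => a _; apply: eq_bigr => b _ /=.
  by rewrite PC.
transitivity (2^-1 * (\sum_a \sum_b P a b * dg a b c
    + \sum_a \sum_b P a b * dg b a c)); first by rewrite -E; field.
rewrite -big_split mulr_sumr mulr_sumr -big_split; apply: eq_bigr => a _ /=.
rewrite -big_split mulr_sumr mulr_sumr -big_split; apply: eq_bigr => b _ /=.
by rewrite lowered; field.
Qed.

Let S := \sum_a \sum_b P a b * h a b.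
Let div := \sum_c u c c.

Let hessian_trace : S =
  div + \sum_d GamP d * phi d + \sum_c gam c * raise P phi c.
Proof.
rewrite -addrA -dg_contract /S /div -big_split /=.
apply: eq_bigr => a _.
transitivity (\sum_b P a b * (\sum_c g b c * u a c)
    + \sum_b P a b * (\sum_c dg a b c * raise P phi c)).
  rewrite -big_split; apply: eq_bigr => b _ /=.
  by rewrite hE big_split /= mulrDr addrC.
congr (_ + _).
under eq_bigr do rewrite mulr_sumr.
rewrite exchange_big /= -[RHS](sum_deltal (fun c => u a c)).
apply: eq_bigr => c _.
have -> : (a == c)%:R = \sum_b P a b * g b c.
  by have := congr1 (fun A : 'M[R]_n => A a c) Pg; rewrite !mxE => <-.
by rewrite mulr_sumr; apply: eq_bigr => b _; ring.
Qed.

Let dT_trace a b : \sum_c dT b c a c = n%:R / 2 * h b a.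
Proof.
rewrite -mulr_sumr sumrB big_split /= -hE sum_deltar.
under eq_bigr do rewrite eqxx mulr1.
by rewrite sumr_const card_ord -mulr_natr; field.
Qed.

Let dT_div : \sum_a \sum_b P a b * (\sum_c dT c c a b) =
  S - \sum_c gam c * raise P phi c - n%:R / 2 * div.
Proof.
have S' : \sum_a \sum_b P a b * h b a = S.
  rewrite exchange_big; apply: eq_bigr => a _; apply: eq_bigr => b _ /=.
  by rewrite PC.
have Hg : \sum_a \sum_b P a b * (\sum_c dg c a b * raise P phi c)
    = 2 * \sum_c gam c * raise P phi c.
  transitivity (\sum_c (\sum_a \sum_b P a b * dg c a b) * raise P phi c).
    under [RHS]eq_bigr do rewrite mulr_suml.
    rewrite [RHS]exchange_big; apply: eq_bigr => a _ /=.
    under [RHS]eq_bigr do rewrite mulr_suml.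
    rewrite [RHS]exchange_big; apply: eq_bigr => b _ /=.
    by rewrite mulr_sumr; apply: eq_bigr => c _; rewrite mulrA.
  rewrite mulr_sumr; apply: eq_bigr => c _; rewrite mulrA; congr (_ * _).
  by rewrite christoffel_trace mulrA divff ?mul1r// pnatr_eq0.
have -> : S - \sum_c gam c * raise P phi c - n%:R / 2 * div =
    2^-1 * (\sum_a \sum_b P a b * h b a + \sum_a \sum_b P a b * h a b
    - \sum_a \sum_b P a b * (\sum_c dg c a b * raise P phi c)
    - (\sum_a \sum_b P a b * g a b) * div).
  by rewrite S' Hg (trace_Pg gT Pg) -/S; field.
rewrite mulr_suml -big_split -!sumrB mulr_sumr; apply: eq_bigr => a _ /=.
rewrite mulr_suml -big_split -!sumrB mulr_sumr; apply: eq_bigr => b _ /=.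
rewrite -mulrA -mulrDr -!mulrBr mulrCA; congr (_ * _).
rewrite -mulr_sumr sumrB !big_split /= !sum_deltar -mulr_sumr -/div.
by ring.
Qed.

(** The part with [dT], the derivatives of [T], produces the trace [S] of the
    derivatives of [phi] ([dT_div], [dT_trace]).  By [hessian_trace], [S] is the
    divergence of the raised [phi] up to terms with [Gam], which combine with
    the mixed products of [Gam] and [T] into the covariant divergence; the
    products of [T] with itself give the quadratic term.  The whole is the
    contraction with [P] of the difference of the Ricci tensors built on
    [Gam + T] and on [Gam]. *)
Lemma conf_curvature_algebra :
  \sum_a \sum_b P a b * (\sum_c (dT c c a b - dT b c a c)
    + \sum_c \sum_d (Gam c c d * T d a b + T c c d * Gam d a b
                     + T c c d * T d a b
                     - Gam c b d * T d a c - T c b d * Gam d a c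
                     - T c b d * T d a c))
  = - (n%:R - 1) * (div + \sum_c gam c * raise P phi c)
    - (n%:R - 1) * (n%:R - 2) / 4 * \sum_c phi c * raise P phi c.
Proof.
have TC c a b : T c a b = T c b a by exact: conf_diffC.
have TP d : \sum_a \sum_b P a b * T d a b = (2 - n%:R) / 2 * raise P phi d.
  exact: conf_diff_contract.
have Tt d : \sum_c T c c d = n%:R / 2 * phi d.
  by under eq_bigr do rewrite TC; exact: conf_diff_trace.
have XG : \sum_a \sum_b P a b * (\sum_c \sum_d Gam c b d * T d a c)
    = 2^-1 * \sum_d GamP d * phi d by exact: conf_diff_cross.
have XT : \sum_a \sum_b P a b * (\sum_c \sum_d T c b d * T d a c)
    = 2^-1 * \sum_d ((2 - n%:R) / 2 * raise P phi d) * phi d.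
  rewrite (conf_diff_cross PT Pg phi TC); congr (_ * _).
  by apply: eq_bigr => d _; congr (_ * _); exact: TP.
have XG' : \sum_a \sum_b P a b * (\sum_c \sum_d T c b d * Gam d a c)
    = 2^-1 * \sum_d GamP d * phi d.
  rewrite -XG exchange_big; apply: eq_bigr => a _; apply: eq_bigr => b _ /=.
  rewrite PC exchange_big; congr (_ * _); apply: eq_bigr => c _.
  by apply: eq_bigr => d _; rewrite mulrC.
have tr (A B : 'I_n -> 'I_n -> 'I_n -> R) :
    \sum_a \sum_b P a b * (\sum_c \sum_d A c c d * B d a b) =
    \sum_d (\sum_c A c c d) * (\sum_a \sum_b P a b * B d a b).
  transitivity (\sum_a \sum_b \sum_d (\sum_c A c c d) * (P a b * B d a b)).
    apply: eq_bigr => a _; apply: eq_bigr => b _.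
    rewrite exchange_big mulr_sumr; apply: eq_bigr => d _ /=.
    by rewrite -mulr_suml; ring.
  under [RHS]eq_bigr do rewrite mulr_sumr.
  rewrite [RHS]exchange_big; apply: eq_bigr => a _ /=.
  under [RHS]eq_bigr do rewrite mulr_sumr.
  by rewrite [RHS]exchange_big.
have X1 : \sum_a \sum_b P a b * (\sum_c \sum_d Gam c c d * T d a b) =
    (2 - n%:R) / 2 * \sum_c gam c * raise P phi c.
  by rewrite tr mulr_sumr; apply: eq_bigr => d _; rewrite TP -/(gam d); ring.
have X2 : \sum_a \sum_b P a b * (\sum_c \sum_d T c c d * Gam d a b) =
    n%:R / 2 * \sum_d GamP d * phi d.
  by rewrite tr mulr_sumr; apply: eq_bigr => d _; rewrite Tt -/(GamP d); ring.
have X3 : \sum_a \sum_b P a b * (\sum_c \sum_d T c c d * T d a b) =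
    n%:R / 2 * ((2 - n%:R) / 2) * \sum_c phi c * raise P phi c.
  by rewrite tr mulr_sumr; apply: eq_bigr => d _; rewrite Tt TP; ring.
have X4 : \sum_a \sum_b P a b * (\sum_c dT b c a c) = n%:R / 2 * S.
  rewrite /S exchange_big mulr_sumr; apply: eq_bigr => a _ /=.
  by rewrite mulr_sumr; apply: eq_bigr => b _; rewrite dT_trace PC; ring.
transitivity ((S - \sum_c gam c * raise P phi c - n%:R / 2 * div)
  - n%:R / 2 * S
  + ((2 - n%:R) / 2 * \sum_c gam c * raise P phi c
  + n%:R / 2 * (\sum_d GamP d * phi d)
  + n%:R / 2 * ((2 - n%:R) / 2) * (\sum_c phi c * raise P phi c)
  - 2^-1 * (\sum_d GamP d * phi d)
  - 2^-1 * (\sum_d GamP d * phi d)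
  - 2^-1 * \sum_d ((2 - n%:R) / 2 * raise P phi d) * phi d)).
  rewrite -dT_div -X1 -X2 -X3 -X4 -{1}XG -XG' -XT.
  pose E F := \sum_a \sum_b P a b * F a b.
  have ED F F' : E F + E F' = E (fun a b => F a b + F' a b).
    rewrite -big_split; apply: eq_bigr => a _ /=; rewrite -big_split /=.
    by apply: eq_bigr => b _; rewrite mulrDr.
  have EB F F' : E F - E F' = E (fun a b => F a b - F' a b).
    rewrite -sumrB; apply: eq_bigr => a _ /=; rewrite -sumrB /=.
    by apply: eq_bigr => b _; rewrite mulrBr.
  rewrite -!/(E _) !(ED, EB); apply: eq_bigr => a _; apply: eq_bigr => b _.
  congr (_ * (_ + _)); first by rewrite sumrB.
  rewrite -!big_split -!sumrB; apply: eq_bigr => c _ /=.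
  by rewrite -!big_split -!sumrB.
have -> : \sum_d (2 - n%:R) / 2 * raise P phi d * phi d =
    (2 - n%:R) / 2 * \sum_c phi c * raise P phi c.
  by rewrite mulr_sumr; apply: eq_bigr => d _; ring.
rewrite hessian_trace.
by field.
Qed.
End CurvatureAlgebra.

(** * Divergence form of the Laplacian *)

Section PderivableRules.
Context {R : realType} {n : nat}.
Implicit Types (D : set 'rV[R]_n) (f g : 'rV[R]_n -> R).

Lemma pderivable_cst D a k x : pderivable D a (fun=> k) x.
Proof. exact: is_pd_pderivable (is_pd_cst D a x k). Qed.

Lemma pderivableD D a f g x : pderivable D a f x -> pderivable D a g x ->
  pderivable D a (fun y => f y + g y) x.
Proof. by move=> fd gd; exact: is_pd_pderivable (is_pdD fd gd). Qed.

Lemma pderivableB D a f g x : pderivable D a f x -> pderivable D a g x ->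
  pderivable D a (fun y => f y - g y) x.
Proof. by move=> fd gd; exact: is_pd_pderivable (is_pdB fd gd). Qed.

Lemma pderivableM D a f g x : pderivable D a f x -> pderivable D a g x ->
  pderivable D a (fun y => f y * g y) x.
Proof. by move=> fd gd; exact: is_pd_pderivable (is_pdM fd gd). Qed.

Lemma pderivable_sum D a (I : Type) (r : seq I) (f : I -> 'rV[R]_n -> R) x :
  (forall i, pderivable D a (f i) x) ->
  pderivable D a (fun y => \sum_(i <- r) f i y) x.
Proof.
by move=> fd; apply: is_pd_pderivable; apply: is_pd_sum => i _; exact: fd.
Qed.
End PderivableRules.

Section Trace.
Context {R : realType} {n : nat}.

Definition christoffel_tr (D : set 'rV[R]_n) (G : 'rV[R]_n -> 'M[R]_n) k y : R :=
  \sum_d christoffel D G d d k y.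

(** The covariant divergence of a vector field; [christoffel_tr] is the
    logarithmic derivative of the volume density ([pd_sqrt_det]). *)
Definition divergence (D : set 'rV[R]_n) (G : 'rV[R]_n -> 'M[R]_n)
    (V : 'I_n -> 'rV[R]_n -> R) y : R :=
  \sum_k (pd D k (V k) y + christoffel_tr D G k y * V k y).

Definition gradient (D : set 'rV[R]_n) (G : 'rV[R]_n -> 'M[R]_n)
    (u : 'rV[R]_n -> R) k y : R :=
  \sum_d ginv G k d y * pd D d u y.

End Trace.

Section MetricField.
Context {R : realType} {n : nat}.
Variables (D : set 'rV[R]_n) (G : 'rV[R]_n -> 'M[R]_n).
Hypothesis Dc : coord_domain D.
Hypothesis GT : forall y, D y -> (G y)^T = G y.
Hypothesis Gu : forall y, D y -> G y \in unitmx.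
Hypothesis Gd : forall y a i j, D y -> pderivable D a (fun z => G z i j) y.

Lemma ginv_sym y : D y -> (invmx (G y))^T = invmx (G y).
Proof. by move=> Dy; rewrite trmx_inv GT. Qed.

Lemma pderivable_ginv a i j y : D y -> pderivable D a (ginv G i j) y.
Proof.
move=> Dy; pose dG := \matrix_(i, j) pd D a (fun z => G z i j) y.
apply: is_pd_pderivable; apply: (is_pd_invmx (dG := dG) Dc Dy Gu) => k l.
by rewrite mxE; exact: Gd.
Qed.

Lemma pd_metric_sym a i j y : D y ->
  pd D a (fun z => G z i j) y = pd D a (fun z => G z j i) y.
Proof.
by move=> Dy; apply: pd_eqD => // z Dz; rewrite -{1}(GT Dz) mxE.
Qed.

(** Jacobi's formula, with cofactors written through the inverse matrix, gives
    half the trace of [G^-1 dG]; so does the contraction of the Christoffel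
    symbols ([christoffel_trace]). *)
Lemma pd_sqrt_det a y : D y -> 0 < \det (G y) ->
  is_pd D a (sqrt_det G) y (christoffel_tr D G a y * sqrt_det G y).
Proof.
move=> Dy det0; pose dG := \matrix_(i, j) pd D a (fun z => G z i j) y.
have dGP i j : is_pd D a (fun z => G z i j) y (dG i j).
  by rewrite mxE; exact: Gd.
apply: is_pd_eq (is_pd_sqrt det0 (is_pd_det dGP)).
have -> : christoffel_tr D G a y = 2^-1 *
    \sum_i \sum_j invmx (G y) i j * pd D a (fun z => G z i j) y.
  apply: (@christoffel_trace R n (invmx (G y)) (ginv_sym Dy)
    (fun d i j => pd D d (fun z => G z i j) y)) => d i j.
  exact: pd_metric_sym.
have E : \sum_i \sum_j dG i j * cofactor (G y) i j = sqrt_det G y ^+ 2 *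
    \sum_i \sum_j invmx (G y) i j * pd D a (fun z => G z i j) y.
  rewrite sqr_sqrtr ?ltW// mulr_sumr; apply: eq_bigr => i _.
  rewrite mulr_sumr; apply: eq_bigr => j _; rewrite mxE.
  have -> : cofactor (G y) i j = \det (G y) * invmx (G y) j i.
    rewrite /invmx Gu// [RHS]/= mxE [\adj _ _ _]mxE mulrA divff ?mul1r//.
    by rewrite gt_eqF.
  have -> : invmx (G y) j i = invmx (G y) i j.
    by rewrite -{1}(ginv_sym Dy) mxE.
  by ring.
have s0 : sqrt_det G y != 0 by rewrite gt_eqF// sqrtr_gt0.
by rewrite E -/(sqrt_det G y); field.
Qed.

Lemma laplacian_div u y : D y -> 0 < \det (G y) ->
  (forall k, pderivable D k (gradient D G u k) y) ->
  laplacian D G u y = - divergence D G (gradient D G u) y.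
Proof.
move=> Dy det0 Vd; congr (- _); rewrite mulr_sumr; apply: eq_bigr => k _.
have s0 : sqrt_det G y != 0 by rewrite gt_eqF// sqrtr_gt0.
have -> := is_pdE Dc Dy (is_pdM (pd_sqrt_det (a := k) Dy det0) (pderivableP (Vd k))).
by rewrite -/(gradient D G u k y); field.
Qed.

Hypothesis Gdd : forall y a b i j, D y ->
  pderivable D b (pd D a (fun z => G z i j)) y.

Lemma pderivable_christoffel e c a b y : D y ->
  pderivable D e (christoffel D G c a b) y.
Proof.
move=> Dy; apply: pderivableM; first exact: pderivable_cst.
apply: pderivable_sum => d; apply: pderivableM; first exact: pderivable_ginv.
by apply: pderivableB; [apply: pderivableD|]; exact: Gdd.
Qed.

Lemma pderivable_gradient u k j y : D y ->
  (forall a, pderivable D j (pd D a u) y) ->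
  pderivable D j (gradient D G u k) y.
Proof.
move=> Dy ud; apply: pderivable_sum => d.
by apply: pderivableM; [exact: pderivable_ginv | exact: ud].
Qed.

End MetricField.

(** * Conformal change of a metric field *)

Lemma quadratic_diff (R : comPzRingType) (x y z t x' y' z' t' : R) :
  (x + y) * (z + t) - (x' + y') * (z' + t') =
  x * z - x' * z'
  + (x * t + y * z + y * t - x' * t' - y' * z' - y' * t').
Proof. by ring. Qed.

Section ConformalChange.
Context {R : realType} {n : nat}.
Variables (D : set 'rV[R]_n) (G : 'rV[R]_n -> 'M[R]_n) (c : 'rV[R]_n -> R).
Hypothesis Dc : coord_domain D.
Hypothesis GT : forall y, D y -> (G y)^T = G y.
Hypothesis Gu : forall y, D y -> G y \in unitmx.
Hypothesis Gd : forall y a i j, D y -> pderivable D a (fun z => G z i j) y.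
Hypothesis c_gt0 : forall y, D y -> 0 < c y.
Hypothesis cd : forall y a, D y -> pderivable D a c y.

Definition dlog a y : R := (c y)^-1 * pd D a c y.
Notation Gc := (fun y => c y *: G y).
Notation P y := (invmx (G y)).
Notation Phi k y := (raise (P y) (dlog^~ y) k).

Let c_neq0 y : D y -> c y != 0.
Proof. by move=> Dy; rewrite gt_eqF// c_gt0. Qed.

Let PG y : D y -> P y *m G y = 1%:M.
Proof. by move=> Dy; rewrite mulVmx// Gu. Qed.

Let pd_c a y : D y -> pd D a c y = c y * dlog a y.
Proof. by move=> Dy; rewrite mulVKf// c_neq0. Qed.

Lemma ginv_conf i j y : D y -> ginv Gc i j y = (c y)^-1 * ginv G i j y.
Proof.
move=> Dy; rewrite /ginv invmxZ ?mxE//.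
by rewrite unitmxZ ?Gu// unitfE c_neq0.
Qed.

Lemma conf_unit y : D y -> Gc y \in unitmx.
Proof. by move=> Dy; rewrite unitmxZ ?Gu// unitfE c_neq0. Qed.

Lemma conf_sym y : D y -> (Gc y)^T = Gc y.
Proof. by move=> Dy; rewrite linearZ /= GT. Qed.

Lemma is_pd_conf a i j y : D y -> is_pd D a (fun z => Gc z i j) y
  (c y * (pd D a (fun z => G z i j) y + dlog a y * G y i j)).
Proof.
move=> Dy; apply: (@is_pd_eqD _ _ _ _ (fun z => c z * G z i j)) => //.
  by move=> z _; rewrite mxE.
apply: is_pd_eq (is_pdM (pderivableP (@cd _ a Dy)) (pderivableP (@Gd _ a i j Dy))).
by rewrite pd_c//; ring.
Qed.

(** The derivatives of [c] contribute products of [dlog] with [g], and raising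
    an index of [g] leaves a Kronecker delta or, in the last term, raises
    [dlog]. *)
Lemma christoffel_conf k a b y : D y -> christoffel D Gc k a b y =
  christoffel D G k a b y + conf_diff (G y) (P y) (dlog^~ y) k a b.
Proof.
move=> Dy; rewrite /christoffel /conf_diff -mulrDr; congr (_ * _).
have GC i j : G y i j = G y j i by rewrite -{1}GT// mxE.
have PGE i j : \sum_d P y i d * G y j d = (i == j)%:R.
  have := congr1 (fun A : 'M[R]_n => A i j) (PG Dy); rewrite !mxE => <-.
  by apply: eq_bigr => d _; rewrite GC.
rewrite -!PGE /raise !mulr_sumr -big_split -sumrB -big_split.
apply: eq_bigr => d _ /=.
rewrite ginv_conf// !(is_pdE Dc Dy (@is_pd_conf _ _ _ _ Dy)) /ginv.
by field; exact: c_neq0.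
Qed.

Lemma contracted_up_conf k y : D y -> contracted_up D Gc k y =
  (c y)^-1 * (contracted_up D G k y + (2 - n%:R) / 2 * Phi k y).
Proof.
move=> Dy; rewrite -(conf_diff_contract (GT Dy) (ginv_sym GT Dy) (PG Dy)).
rewrite -big_split mulr_sumr; apply: eq_bigr => a _ /=.
rewrite -big_split mulr_sumr; apply: eq_bigr => b _ /=.
by rewrite ginv_conf// christoffel_conf// /ginv; ring.
Qed.

Lemma contracted_down_conf a y : D y -> contracted_down D Gc a y =
  contracted_down D G a y + (2 - n%:R) / 2 * dlog a y.
Proof.
move=> Dy.
rewrite -(lower_raise (GT Dy) (ginv_sym GT Dy) (PG Dy) (dlog^~ y)).
rewrite mulr_sumr -big_split; apply: eq_bigr => b _ /=.
by rewrite mxE contracted_up_conf//; field; exact: c_neq0.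
Qed.

Lemma christoffel_tr_conf k y : D y -> christoffel_tr D Gc k y =
  christoffel_tr D G k y + n%:R / 2 * dlog k y.
Proof.
move=> Dy.
rewrite -(conf_diff_trace (GT Dy) (ginv_sym GT Dy) (PG Dy) (dlog^~ y)).
rewrite -big_split; apply: eq_bigr => d _ /=.
by rewrite christoffel_conf// [conf_diff _ _ _ d k d]conf_diffC// GT.
Qed.

Hypothesis Gdd : forall y a b i j, D y ->
  pderivable D b (pd D a (fun z => G z i j)) y.
Hypothesis cdd : forall y a b, D y -> pderivable D b (pd D a c) y.

Lemma pderivable_dlog b a y : D y -> pderivable D b (dlog a) y.
Proof.
move=> Dy; apply: pderivableM; last exact: cdd.
exact: is_pd_pderivable (is_pdV (c_neq0 Dy) (pderivableP (@cd _ b Dy))).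
Qed.

Lemma pderivable_Phi b k y : D y -> pderivable D b (fun z => Phi k z) y.
Proof.
move=> Dy; apply: pderivable_sum => d; apply: pderivableM.
  exact: pderivable_ginv.
exact: pderivable_dlog.
Qed.

Let dT y e k a b : R := 2^-1 * (pd D e (dlog a) y * (k == b)%:R
  + pd D e (dlog b) y * (k == a)%:R
  - (pd D e (fun z => G z a b) y * Phi k y
     + G y a b * pd D e (fun z => Phi k z) y)).

Lemma is_pd_conf_diff e k a b y : D y ->
  is_pd D e (fun z => conf_diff (G z) (P z) (dlog^~ z) k a b) y (dT y e k a b).
Proof.
move=> Dy; rewrite /conf_diff /dT; apply: is_pdZ; apply: is_pdB.
  apply: is_pdD.
    apply: is_pd_eq (is_pdM (pderivableP (@pderivable_dlog e a _ Dy)) (is_pd_cst _ _ _ _)).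
    by rewrite mulr0 addr0.
  apply: is_pd_eq (is_pdM (pderivableP (@pderivable_dlog e b _ Dy)) (is_pd_cst _ _ _ _)).
  by rewrite mulr0 addr0.
exact: is_pdM (pderivableP (@Gd _ _ _ _ Dy)) (pderivableP (@pderivable_Phi _ _ _ Dy)).
Qed.

Lemma pd_christoffel_conf e k a b y : D y ->
  pd D e (christoffel D Gc k a b) y =
  pd D e (christoffel D G k a b) y + dT y e k a b.
Proof.
move=> Dy; apply: (is_pdE Dc Dy).
apply: (is_pd_eqD Dy (fun z Dz => esym (@christoffel_conf k a b _ Dz))).
apply: is_pdD (@is_pd_conf_diff _ _ _ _ _ Dy).
exact: pderivable_christoffel.
Qed.

(** The hypothesis of [conf_curvature_algebra] that relates the derivatives of
    [dlog] to those of the raised field comes from differentiating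
    [g_bk phi^k = phi_b]. *)
Lemma scalar_curvature_conf y : D y ->
  c y * scalar_curvature D Gc y = scalar_curvature D G y
  - (n%:R - 1) * divergence D G (fun k z => Phi k z) y
  - (n%:R - 1) * (n%:R - 2) / 4 * \sum_k dlog k y * Phi k y.
Proof.
move=> Dy; rewrite -addrA -mulNr /divergence big_split /=.
have hE a b : pd D a (dlog b) y = \sum_k (pd D a (fun z => G z b k) y * Phi k y
    + G y b k * pd D a (fun z => Phi k z) y).
  apply: (is_pdE Dc Dy).
  apply: (@is_pd_eqD _ _ _ _ (fun z => \sum_k G z b k * Phi k z)) => //.
    by move=> z Dz; rewrite (lower_raise (GT Dz) (ginv_sym GT Dz) (PG Dz)).
  apply: is_pd_sum => k _.
  exact: is_pdM (pderivableP (@Gd _ _ _ _ Dy)) (pderivableP (@pderivable_Phi _ _ _ Dy)).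
have := conf_curvature_algebra (GT Dy) (ginv_sym GT Dy) (PG Dy)
  (fun d a b => pd_metric_sym GT d a b Dy) hE.
move=> <-.
rewrite /scalar_curvature -big_split mulr_sumr; apply: eq_bigr => a _ /=.
rewrite -big_split mulr_sumr; apply: eq_bigr => b _ /=.
rewrite ginv_conf// -mulrA mulVKf ?c_neq0// -mulrDr; congr (_ * _).
rewrite /ricci [RHS]addrACA; congr (_ + _).
  rewrite -big_split; apply: eq_bigr => k _ /=.
  by rewrite !pd_christoffel_conf// opprD addrACA.
rewrite -big_split; apply: eq_bigr => k _ /=.
rewrite -big_split; apply: eq_bigr => d _ /=.
rewrite !christoffel_conf//; exact: quadratic_diff.
Qed.

Hypothesis det_gt0 : forall y, D y -> 0 < \det (G y).
Variable u : 'rV[R]_n -> R.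
Hypothesis ud : forall y a, D y -> pderivable D a u y.
Hypothesis udd : forall y a b, D y -> pderivable D b (pd D a u) y.

Notation V k y := (gradient D G u k y).

(** In terms of [dlog] powers of [c] differentiate like exponentials, which
    keeps every later formula polynomial. *)
Lemma is_pd_conf_power s a y : D y ->
  is_pd D a (fun z => c z `^ s) y (s * c y `^ s * dlog a y).
Proof.
move=> Dy.
apply: is_pd_eq (is_pd_powR (s := s) (c_gt0 Dy) (pderivableP (@cd _ a Dy))).
rewrite pd_c// mulrA -[s * _ * c y]mulrA [_ `^ _ * c y]mulrC.
rewrite [c y * _](_ : _ = c y `^ s) //.
rewrite -{1}(powRr1 (ltW (c_gt0 Dy))) -powRD ?c_neq0 ?implybT//.
by congr (_ `^ _); ring.
Qed.

Lemma powR_subr1 s y : D y -> c y `^ (s - 1) = (c y)^-1 * c y `^ s.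
Proof.
by move=> Dy; rewrite powRD ?c_neq0 ?implybT// powR_inv1 ?ltW ?c_gt0// mulrC.
Qed.

Lemma gradient_conf s k y : D y ->
  gradient D Gc (fun z => c z `^ s * u z) k y =
  c y `^ (s - 1) * (V k y + s * u y * Phi k y).
Proof.
move=> Dy; rewrite powR_subr1// /gradient /raise mulr_sumr -big_split mulr_sumr.
apply: eq_bigr => d _ /=; rewrite ginv_conf//.
rewrite (is_pdE Dc Dy (is_pdM (@is_pd_conf_power s d _ Dy) (pderivableP (@ud _ d Dy)))).
by rewrite /ginv; ring.
Qed.

(** Both sides are written as divergences.  The coefficient of the product of
    the gradients of [ln c] and [u] is [2 s - 1 + n/2], which vanishes for this
    [s]. *)
Lemma laplacian_conf y : D y ->
  let s := - ((n%:R - 2) / 4) in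
  laplacian D Gc (fun z => c z `^ s * u z) y =
  c y `^ (s - 1) * (laplacian D G u y - s * u y * divergence D G (fun k z => Phi k z) y
    + s ^+ 2 * u y * \sum_k dlog k y * Phi k y).
Proof.
move=> Dy s.
have Vd b k : pderivable D b (fun z => V k z) y.
  by apply: pderivable_gradient => // a; exact: udd.
have gE k z : D z -> gradient D Gc (fun z => c z `^ s * u z) k z =
    c z `^ (s - 1) * (V k z + s * u z * Phi k z) by exact: gradient_conf.
have gP b k : is_pd D b (fun z => gradient D Gc (fun z => c z `^ s * u z) k z) y
    ((s - 1) * c y `^ (s - 1) * dlog b y * (V k y + s * u y * Phi k y) +
     c y `^ (s - 1) * (pd D b (fun z => V k z) y +
       (s * pd D b u y * Phi k y + s * u y * pd D b (fun z => Phi k z) y))).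
  apply: (is_pd_eqD Dy (fun z Dz => esym (@gE k z Dz))).
  apply: is_pdM; first exact: is_pd_conf_power.
  apply: is_pdD; first exact: Vd.
  apply: is_pdM; last exact: pderivable_Phi.
  by apply: is_pdZ; exact: ud.
have cd' : forall y a i j, D y -> pderivable D a (fun z => Gc z i j) y.
  by move=> z a i j Dz; exact: is_pd_pderivable (@is_pd_conf a i j _ Dz).
rewrite (laplacian_div Dc conf_sym conf_unit cd' Dy); last first.
- by move=> k; exact: is_pd_pderivable (@gP k k).
- by rewrite detZ mulr_gt0 ?det_gt0// exprn_gt0// c_gt0.
rewrite (laplacian_div Dc GT Gu Gd Dy (det_gt0 Dy) (fun k => Vd k k)).
(* The pairing of the two gradients does not depend on which one is raised. *)
have X : \sum_k dlog k y * V k y = \sum_k pd D k u y * Phi k y.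
  rewrite [RHS](sum_raise (ginv_sym GT Dy)); apply: eq_bigr => k _.
  by rewrite mulrC.
rewrite -[LHS]opprK -[RHS]opprK; congr (- _).
transitivity (c y `^ (s - 1) * (divergence D G (gradient D G u) y
  + s * u y * divergence D G (fun k z => Phi k z) y
  + (s - 1 + n%:R / 2) * (\sum_k dlog k y * V k y)
  + s * (\sum_k pd D k u y * Phi k y)
  + s * (s - 1 + n%:R / 2) * u y * \sum_k dlog k y * Phi k y)); last first.
  rewrite X (_ : s - 1 + n%:R / 2 = - s); first by ring.
  by rewrite /s; field.
rewrite opprK /divergence !mulr_sumr -!big_split mulr_sumr.
apply: eq_bigr => k _ /=.
rewrite (is_pdE Dc Dy (gP k k)) gE// christoffel_tr_conf//.
by ring.
Qed.

(** The multiples of [u] in [laplacian_conf] that contain derivatives of [c] are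
    those of the curvature term with the opposite sign, since [s = - (n-2)/4]. *)
Lemma conf_laplacian_coord_conf y : (1 < n)%N -> D y ->
  let s := - ((n%:R - 2) / 4) in
  conf_laplacian_coord D Gc (fun z => c z `^ s * u z) y =
  c y `^ (s - 1) * conf_laplacian_coord D G u y.
Proof.
move=> n1 Dy s.
have n10 : n%:R - 1 != 0 :> R by rewrite subr_eq0 pnatr_eq1 gtn_eqF.
rewrite /conf_laplacian_coord laplacian_conf//.
have := scalar_curvature_conf Dy.
move/(congr1 (fun t => (c y)^-1 * t)); rewrite mulKf ?c_neq0// => ->.
rewrite powR_subr1// /s.
by field; rewrite n10 c_neq0.
Qed.

End ConformalChange.

(** * Restriction to relatively open subsets *)

Section Locality.
Context {R : realType} {n : nat}.
Variables (W D : set 'rV[R]_n).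
Hypothesis WD : relopen W D.
Variable G : 'rV[R]_n -> 'M[R]_n.

Lemma pd_relopen_eq a f f' y : W y -> (forall z, W z -> f z = f' z) ->
  pd D a f y = pd W a f' y.
Proof. by move=> Wy ff'; rewrite (pd_relopen a f WD Wy); exact: pd_eqD. Qed.

Lemma christoffel_relopen c a b y : W y ->
  christoffel D G c a b y = christoffel W G c a b y.
Proof.
move=> Wy; congr (_ * _); apply: eq_bigr => d _.
by rewrite -!(pd_relopen _ _ WD Wy).
Qed.

Lemma scalar_curvature_relopen y : W y ->
  scalar_curvature D G y = scalar_curvature W G y.
Proof.
move=> Wy; apply: eq_bigr => a _; apply: eq_bigr => b _; congr (_ * (_ + _)).
  apply: eq_bigr => c _; congr (_ - _);
  by apply: pd_relopen_eq => // z Wz; exact: christoffel_relopen.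
apply: eq_bigr => c _; apply: eq_bigr => d _.
by rewrite !christoffel_relopen.
Qed.

(** On a relatively open set all derivatives agree, including the nested ones,
    because the inner derivatives agree on the whole set. *)
Lemma conf_laplacian_coord_relopen u y : W y ->
  conf_laplacian_coord D G u y = conf_laplacian_coord W G u y.
Proof.
move=> Wy; rewrite /conf_laplacian_coord scalar_curvature_relopen//.
congr (- (_ * _) + _); apply: eq_bigr => a _.
apply: pd_relopen_eq => // z Wz; congr (_ * _); apply: eq_bigr => b _.
by rewrite (pd_relopen _ _ WD Wz).
Qed.

End Locality.

(** * Positive definite matrices *)

(** Along the segment from the identity to [A] all matrices are positive
    definite, hence invertible, so that the determinant, a polynomial in the
    parameter which is [1] at the identity, cannot change sign. *)
Lemma posdef_det_gt0 (R : realType) n (A : 'M[R]_n) :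
  (forall v : 'rV[R]_n, v != 0 -> 0 < (v *m A *m v^T) ord0 ord0) -> 0 < \det A.
Proof.
move=> Apos; rewrite ltNge; apply/negP => A0.
(* The segment, as a matrix of polynomials in its parameter. *)
pose M : 'M[{poly R}]_n := 'X *: map_mx polyC A + (1 - 'X)%:M.
have MsE s : (\det M).[s] = \det (s *: A + (1 - s)%:M).
  rewrite -horner_evalE -det_map_mx; congr (\det _); apply/matrixP => i j.
  rewrite !mxE /= horner_evalE !hornerE /=; congr (_ + _).
  by case: (i == j); rewrite ?mulr1n ?mulr0n !hornerE.
have [s /andP[s0 s1]] : exists2 s : R, 0 <= s <= 1 & root (- \det M) s.
  apply: poly_ivt => //; rewrite !hornerN !MsE.
  by rewrite scale0r add0r subr0 det1 lerN10 scale1r subrr raddf0 addr0 oppr_ge0.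
rewrite rootE hornerN MsE oppr_eq0 => /det0P[v v0 vM].
have vv : 0 < (v *m v^T) ord0 ord0.
  rewrite mxE lt_neqAle; apply/andP; split; last first.
    by apply: sumr_ge0 => j _; rewrite mxE -expr2 sqr_ge0.
  rewrite eq_sym; apply: contra v0 => v0.
  apply/eqP/rowP => j; rewrite mxE; apply/eqP; rewrite -sqrf_eq0.
  move: v0; rewrite psumr_eq0 => [/allP/(_ j)|i _].
    by rewrite mem_index_enum mxE => /(_ isT).
  by rewrite mxE -expr2 sqr_ge0.
have : ((v *m (s *: A + (1 - s)%:M)) *m v^T) ord0 ord0 = 0.
  by rewrite vM mul0mx mxE.
rewrite mulmxDr mul_mx_scalar -scalemxAr mulmxDl -!scalemxAl mxE.
have mxZ (t : R) (B : 'M[R]_1) : (t *: B) ord0 ord0 = t * B ord0 ord0.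
  by rewrite mxE.
rewrite !mxZ => E.
have := Apos v v0; nra.
Qed.

(** * Coordinate changes on a manifold *)

Section ManifoldCalculus.
Context {R : realType} {n : nat} {M : smooth_manifold R n}.
Implicit Types (C : coords R n M) (V : set M) (p q : M) (f : M -> R).

Definition coord_image C V : set 'rV[R]_n := cmap C @` (cdom C `&` V).

Lemma relopen_coord_image C V : is_coords C -> open V ->
  relopen (coord_image C V) (cimage C).
Proof.
move=> [Co CK Cc Cic Cd] Vo; split; first by move=> _ [p [Cp _] <-]; exists p.
move=> _ [p [Cp Vp] <-].
move/subspace_continuousP: Cic => Cic.
have Dp : cimage C (cmap C p) by exists p.
have pV : nbhs (cinv C (cmap C p)) V by rewrite CK//; exact: open_nbhs_nbhs.
have := Cic _ Dp _ pV; rewrite /= => H.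
have {}H : \forall y \near cmap C p, cimage C y -> V (cinv C y) := H.
apply: filterS H => y Hy Dy; have := Hy Dy.
by case: Dy => q Cq <-; rewrite CK// => Vq; exists q.
Qed.

Lemma coord_domain_image C V : is_coords C -> open V ->
  coord_domain (coord_image C V).
Proof.
move=> HC Vo; apply: coord_domain_relopen (relopen_coord_image HC Vo) _.
by case: HC.
Qed.

Lemma mem_coord_image C V p : cdom C p -> V p -> coord_image C V (cmap C p).
Proof. by move=> Cp Vp; exists p. Qed.

Lemma coord_imageT C : coord_image C setT = cimage C.
Proof. by rewrite /coord_image setIT. Qed.

(** The transition map is only defined where the coordinate systems overlap;
    there [f] in the coordinates [C] is [f] in the coordinates [C'] composed
    with the transition map, and [is_pd_chain] applies. *)
Lemma partial_chain C C' V f a p : is_coords C -> is_coords C' ->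
  transition_Ck 1 C C' -> open V -> Ck 1 (coord_image C' V) (f \o cinv C') ->
  cdom C p -> cdom C' p -> V p ->
  is_pd (cimage C) a (f \o cinv C) (cmap C p)
    (\sum_k partial C' k f p *
            partial C a (fun q => cmap C' q ord0 k) p).
Proof.
move=> HC HC' CC' Vo fC Cp C'p Vp.
have [C'o C'K _ _ _] := HC'; have [_ CK _ _ _] := HC.
have VC'o : open (cdom C' `&` V) by exact: openI.
pose W := coord_image C (cdom C' `&` V).
have WD : relopen W (cimage C) by exact: relopen_coord_image.
have WC' : relopen (coord_image C (cdom C')) (cimage C).
  exact: relopen_coord_image.
have Wp : W (cmap C p) by exact: mem_coord_image.
have phiE q : cdom C q -> cdom C' q -> V q ->
    (cmap C' \o cinv C) (cmap C q) = cmap C' q by move=> Cq _ _ /=; rewrite CK.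
have phiP y : W y -> coord_image C' V ((cmap C' \o cinv C) y).
  by move=> [q [Cq [C'q Vq]] <-]; rewrite phiE//; exact: mem_coord_image.
have dphi k : is_pd W a (fun y => (cmap C' \o cinv C) y ord0 k) (cmap C p)
    (partial C a (fun q => cmap C' q ord0 k) p).
  apply/(is_pd_relopen _ _ _ WD Wp).
  have W'p : coord_image C (cdom C') (cmap C p) by exact: mem_coord_image.
  have := pderivableP (Ck_pderivable (a := a) (CC' k) W'p).
  rewrite -(pd_relopen _ _ WC' W'p).
  by move/(is_pd_relopen _ _ _ WC' W'p).
apply/(is_pd_relopen _ _ _ WD Wp).
have := is_pd_chain (coord_domain_image HC' Vo) phiP Wp fC dphi.
rewrite phiE// => H.
have {}H := is_pd_eqD Wp (g := f \o cinv C) _ H.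
apply: is_pd_eq (H _).
  apply: eq_bigr => k _; congr (_ * _); rewrite /partial.
  rewrite (pd_relopen _ _ (relopen_coord_image HC' Vo))//.
  exact: mem_coord_image.
by move=> _ [q [Cq [C'q Vq]] <-] /=; rewrite CK// C'K.
Qed.

Lemma partial_chainE C C' V f a p : is_coords C -> is_coords C' ->
  transition_Ck 1 C C' -> open V -> Ck 1 (coord_image C' V) (f \o cinv C') ->
  cdom C p -> cdom C' p -> V p ->
  partial C a f p =
    \sum_k partial C' k f p * partial C a (fun q => cmap C' q ord0 k) p.
Proof.
move=> HC HC' CC' Vo fC Cp C'p Vp; have [_ _ _ _ Cd] := HC.
apply: is_pdE; rewrite //; first by exists p.
exact: partial_chain fC _ _ _.
Qed.

Definition transition_jac C C' p : 'M[R]_n :=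
  \matrix_(c, a) partial C a (fun q => cmap C' q ord0 c) p.

Lemma jac_refl C p : is_coords C -> cdom C p -> transition_jac C C p = 1%:M.
Proof.
move=> [_ CK _ _ Cd] Cp; apply/matrixP => c a; rewrite !mxE.
have Dp : cimage C (cmap C p) by exists p.
apply: (is_pdE Cd Dp).
apply: (@is_pd_eqD _ _ _ _ (fun y => y ord0 c)) => //; last first.
  exact: is_pd_coord.
by move=> _ [q Cq <-] /=; rewrite CK.
Qed.

Lemma jac_comp C C' C'' p : is_coords C -> is_coords C' -> is_coords C'' ->
  transition_Ck 1 C C' -> transition_Ck 1 C' C'' ->
  cdom C p -> cdom C' p -> cdom C'' p ->
  transition_jac C C'' p = transition_jac C' C'' p *m transition_jac C C' p.
Proof.
move=> HC HC' HC'' CC' C'C'' Cp C'p C''p; have [C''o _ _ _ _] := HC''.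
apply/matrixP => c a; rewrite !mxE.
rewrite (partial_chainE a HC HC' CC' C''o (C'C'' c))//.
by apply: eq_bigr => k _; rewrite !mxE.
Qed.

(** The Jacobian matrices of the two transitions are inverse to each other. *)
Lemma jac_unit C C' p : is_coords C -> is_coords C' ->
  transition_Ck 1 C C' -> transition_Ck 1 C' C ->
  cdom C p -> cdom C' p -> transition_jac C C' p \in unitmx.
Proof.
move=> HC HC' CC' C'C Cp C'p.
have := jac_comp HC HC' HC CC' C'C Cp C'p Cp; rewrite jac_refl//.
by move/esym/mulmx1_unit => [].
Qed.

Variable g : tensor2 M.

Lemma tensor_comp_conf (c : M -> R) C x :
  tensor_comp (conf_scale c g) C x = c (cinv C x) *: tensor_comp g C x.
Proof. by rewrite /tensor_comp /conf_scale -scalemxAr -scalemxAl. Qed.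

Hypothesis g_sym : forall p, (g p)^T = g p.
Hypothesis g_pos :
  forall p (v : 'rV[R]_n), v != 0 -> 0 < (v *m g p *m v^T) ord0 ord0.

Lemma tensor_comp_sym C x : (tensor_comp g C x)^T = tensor_comp g C x.
Proof. by rewrite /tensor_comp !trmx_mul trmxK g_sym mulmxA. Qed.

(** [tensor_comp] refers to the selected chart at each point, which jumps as the
    point moves.  This form refers to one coordinate system [C'] near the point
    and can be differentiated. *)
Lemma tensor_comp_change C C' p : is_coords C -> is_coords C' ->
  transition_Ck 1 C C' ->
  transition_Ck 1 C' (chart (chart_at p)) ->
  cdom C p -> cdom C' p ->
  tensor_comp g C (cmap C p) =
  (transition_jac C C' p)^T *m tensor_comp g C' (cmap C' p) *m transition_jac C C' p.
Proof.
move=> HC HC' CC' C'i Cp C'p.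
have [_ CK _ _ _] := HC; have [_ C'K _ _ _] := HC'.
rewrite /tensor_comp CK// C'K//.
have -> : Defs.jacobian C p = Defs.jacobian C' p *m transition_jac C C' p.
  exact: jac_comp HC HC' (chart_is_coords _) CC' C'i Cp C'p (chart_atP _).
by rewrite trmx_mul !mulmxA.
Qed.

(** Congruence by an invertible Jacobian multiplies the determinant by a
    positive square. *)
Lemma tensor_comp_det_gt0 C p : is_coords C ->
  transition_Ck 1 C (chart (chart_at p)) ->
  transition_Ck 1 (chart (chart_at p)) C ->
  cdom C p -> 0 < \det (tensor_comp g C (cmap C p)).
Proof.
move=> HC Ci iC Cp; have [_ CK _ _ _] := HC.
rewrite /tensor_comp CK// !det_mulmx det_tr mulrAC -expr2.
rewrite mulr_gt0 ?posdef_det_gt0//; last exact: g_pos.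
rewrite exprn_even_gt0//= -unitfE -unitmxE.
exact: jac_unit HC (chart_is_coords _) Ci iC Cp (chart_atP _).
Qed.

End ManifoldCalculus.

(** * Regularity of the metric and of its components *)

Section Regularity.
Context {R : realType} {n : nat} {M : smooth_manifold R n}.
Implicit Types (C : coords R n M) (p q : M).

Lemma Cr_Ck2 (r : R) (D : set 'rV[R]_n) f : 2 < r -> Cr r D f -> Ck 2 D f.
Proof.
move=> r2; apply: Ck_withW.
by rewrite truncn_gt_nat ltW.
Qed.

Lemma transition_CkW j k C C' : (j <= k)%N ->
  transition_Ck k C C' -> transition_Ck j C C'.
Proof. by move=> jk h a; exact: Ck_withW (h a). Qed.

Variables (r : R) (g : tensor2 M).
Hypotheses (r2 : 2 < r) (hg : riemannian_metric r g).

Lemma Ck2_tensor_chart (i : chart_index M) a b :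
  Ck 2 (cimage (chart i)) (fun x => tensor_comp g (chart i) x a b).
Proof. by case: hg => _ _ /(_ i a b); exact: Cr_Ck2. Qed.

(** Near [p] the components in [C] are products of entries of the Jacobian of
    the transition to a fixed chart, which are [C^1] since the transition is
    [C^2], and of components in that chart composed with the transition. *)
Lemma pderivable_tensor_comp C a i j p : is_coords C ->
  (forall k, transition_Ck 2 C (chart k)) -> cdom C p ->
  pderivable (cimage C) a (fun x => tensor_comp g C x i j) (cmap C p).
Proof.
move=> HC CC Cp; set k := chart_at p; pose Ci := chart k.
have HCi : is_coords Ci := chart_is_coords k.
have [Cio CiK _ _ _] := HCi; have [_ CK _ _ _] := HC.
have Cip : cdom Ci p := chart_atP p.
have WD := relopen_coord_image HC Cio.
have Wp := mem_coord_image Cp Cip.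
set W := coord_image C (cdom Ci) in WD Wp.
have C1 : transition_Ck 1 C Ci by apply: transition_CkW (CC k).
have JD b d : pderivable W a (fun y => transition_jac C Ci (cinv C y) b d) (cmap C p).
  apply: is_pd_pderivable; apply: (@is_pd_eqD _ _ _ _
    (pd W d (fun y => cmap Ci (cinv C y) ord0 b))) => //; last first.
    exact: pderivableP (Ck_pderivable (a := a) (Ck_pd d (CC k b)) Wp).
  move=> _ [q [Cq Ciq] <-]; rewrite mxE /partial CK//.
  by rewrite (pd_relopen _ _ WD)//; exact: mem_coord_image.
have GD b d : pderivable W a
    (fun y => tensor_comp g Ci (cmap Ci (cinv C y)) b d) (cmap C p).
  apply: is_pd_pderivable; apply/(is_pd_relopen _ _ _ WD Wp).
  apply: (@partial_chain _ _ _ C Ci setT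
    (fun q => tensor_comp g Ci (cmap Ci q) b d) a p HC HCi C1) => //.
    exact: openT.
  rewrite coord_imageT; apply: Ck_eqD (CkS (Ck2_tensor_chart k b d)).
  by move=> _ [q Ciq <-] /=; rewrite CiK.
apply: is_pd_pderivable; apply/(is_pd_relopen _ _ _ WD Wp).
(* The transformation law, with every factor a function of the coordinates
   of [C]. *)
apply: (@is_pd_eqD _ _ _ _ (fun y => \sum_d (\sum_b transition_jac C Ci (cinv C y) b i *
    tensor_comp g Ci (cmap Ci (cinv C y)) b d) * transition_jac C Ci (cinv C y) d j)) => //;
    last first.
  apply: pderivableP.
  apply: pderivable_sum => d; apply: pderivableM; last exact: JD.
  by apply: pderivable_sum => b; apply: pderivableM; [exact: JD | exact: GD].
move=> _ [q [Cq Ciq] <-].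
rewrite CK// (tensor_comp_change _ HC HCi C1)//; last first.
  by apply: chart_smooth.
rewrite mxE; apply: eq_bigr => d _; congr (_ * _).
by rewrite [RHS]mxE; apply: eq_bigr => b _; rewrite [_^T _ _]mxE.
Qed.

End Regularity.

(** * The conformal law *)

Theorem proposition2p6 (R : realType) (n : nat) (M : smooth_manifold R n)
    (r : R) (g : tensor2 M) (Z : coords R n M) (fg c : M -> R)
    (hn : (3 <= n)%N) (hr : 2 < r) (hg : riemannian_metric r g)
    (hZ : conf_harmonic_coordinates g Z)
    (fg_gt0 : forall p, cdom Z p -> 0 < fg p)
    (hfg : conf_laplace_solution g (cdom Z) fg)
    (hGamma : forall (a : 'I_n) (p : M), cdom Z p ->
       contracted_christoffel g Z a p
       = 2 * partial Z a (fun q => ln (fg q)) p)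
    (hc : Cr_on r [set: M] c) (c_gt0 : forall p, 0 < c p) :
  let fcg := fun p : M => c p `^ (- ((n%:R - 2) / 4)) * fg p in
  [/\ forall (a : 'I_n) (p : M), cdom Z p ->
        contracted_christoffel (conf_scale c g) Z a p
        = 2 * partial Z a (fun q => ln (fcg q)) p,
      forall p, cdom Z p -> 0 < fcg p &
      conf_laplace_solution (conf_scale c g) (cdom Z) fcg].
Proof.
move=> fcg; have [[HZ iZ Zi _] _] := hZ; have [Zo ZK _ _ Zd] := HZ.
have [gsym gpos _] := hg; have [fgC fgL] := hfg.
have tcE C : tensor_comp (conf_scale c g) C =
    (fun x => c (cinv C x) *: tensor_comp g C x).
  by apply/funext => x; exact: tensor_comp_conf.
have cC i : Ck 2 (cimage (chart i)) (c \o cinv (chart i)).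
  by rewrite -coord_imageT; apply: Cr_Ck2 hr (hc i).
have iZ1 i : transition_Ck 1 (chart i) Z by exact: transition_CkW (iZ i).
have Zi1 i : transition_Ck 1 Z (chart i) by exact: transition_CkW (Zi i).
have det_gt0 C p : is_coords C -> transition_Ck 1 C (chart (chart_at p)) ->
    transition_Ck 1 (chart (chart_at p)) C -> cdom C p ->
    0 < \det (tensor_comp g C (cmap C p)) by exact: tensor_comp_det_gt0.
split.
- move=> a p Zp; have Dp : cimage Z (cmap Z p) by exists p.
  have Hi := chart_is_coords (chart_at p); have ip := chart_atP p.
  rewrite /contracted_christoffel tcE.
  rewrite (contracted_down_conf (c := c \o cinv Z) Zd)//.
  (* Both sides are now combinations of the derivatives of [ln c] and [ln fg],
     once these are known to exist. *)
  + rewrite -/(contracted_christoffel g Z a p) hGamma// /partial.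
    have cd : pderivable (cimage Z) a (c \o cinv Z) (cmap Z p).
      apply: is_pd_pderivable; apply: partial_chain HZ Hi (Zi1 _) openT _ _ _ _.
      * by rewrite coord_imageT; exact: CkS.
      * by [].
      * by [].
      * by [].
    have fd : pderivable (cimage Z) a (fg \o cinv Z) (cmap Z p).
      apply: is_pd_pderivable; apply: partial_chain HZ Hi (Zi1 _) Zo _ _ _ _.
      * by apply: CkS; exact: fgC.
      * by [].
      * by [].
      * by [].
    have lc := is_pd_ln (c_gt0 (cinv Z (cmap Z p))) (pderivableP cd).
    have fp : 0 < (fg \o cinv Z) (cmap Z p) by rewrite /= ZK//; exact: fg_gt0.
    have lf := is_pd_ln fp (pderivableP fd).
    have lfc := is_pdD (is_pdZ (k := - ((n%:R - 2) / 4)) lc) lf.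
    have {}lfc := is_pd_eqD Dp (g := (fun q => ln (fcg q)) \o cinv Z) _ lfc.
    rewrite (is_pdE Zd Dp (lfc _)); last first.
      move=> _ [q Zq <-] /=; rewrite /fcg lnM ?ln_powR// posrE ?powR_gt0//.
      by rewrite ZK// fg_gt0.
    rewrite (is_pdE Zd Dp lf) /dlog /=.
    by set F := (fg _)^-1 * _; set B := (c _)^-1 * _; field.
  + by move=> y _; exact: tensor_comp_sym.
  + move=> _ [q Zq <-]; rewrite unitmxE unitfE gt_eqF//.
    exact: det_gt0.
  + by move=> _ b i j [q Zq <-]; apply: (pderivable_tensor_comp hr hg).
  + by move=> y _; exact: c_gt0.
  + move=> _ b [q Zq <-].
    apply: is_pd_pderivable.
    apply: (@partial_chain _ _ _ Z (chart (chart_at q)) setT) => //.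
    * exact: chart_is_coords.
    * exact: openT.
    * by rewrite coord_imageT; exact: CkS.
    * exact: chart_atP.
- by move=> p Zp; rewrite mulr_gt0 ?powR_gt0 ?fg_gt0.
have cW i : Ck 2 (coord_image (chart i) (cdom Z)) (c \o cinv (chart i)).
  exact: Ck_relopen (relopen_coord_image (chart_is_coords i) Zo) (cC i).
split.
  move=> i; have Wd := coord_domain_image (chart_is_coords i) Zo.
  apply: (CkM Wd (f := fun x => (c \o cinv (chart i)) x `^ _)) (fgC i).
  by apply: Ck_powR => // y _; exact: c_gt0.
move=> p Zp; pose C := chart (chart_at p).
have HC : is_coords C := chart_is_coords _.
have Cp : cdom C p := chart_atP p.
have [_ CK _ _ _] := HC.
have WD := relopen_coord_image HC Zo.
have Wd := coord_domain_image HC Zo.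
have Wp := mem_coord_image Cp Zp.
set W := coord_image C (cdom Z) in WD Wd Wp.
have GW a b : Ck 2 W (fun x => tensor_comp g C x a b).
  by apply: Ck_relopen WD _; exact: Ck2_tensor_chart hr hg _ _ _.
have det0 y : W y -> 0 < \det (tensor_comp g C y).
  by move=> [q [Cq Zq] <-]; apply: det_gt0 => //; exact: chart_smooth.
rewrite /conf_laplacian tcE -/C (conf_laplacian_coord_relopen WD)//.
rewrite (@conf_laplacian_coord_conf _ _ W (tensor_comp g C) (c \o cinv C) Wd
  _ _ _ _ _ _ _ det0 (fg \o cinv C))//.
- have := fgL p Zp; rewrite /conf_laplacian -/C.
  by rewrite (conf_laplacian_coord_relopen WD)// => ->; rewrite mulr0.
- by move=> y _; exact: tensor_comp_sym.
- by move=> y Wy; rewrite unitmxE unitfE gt_eqF// det0.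
- by move=> y a i j Wy; exact: Ck_pderivable (GW i j) Wy.
- by move=> y _; exact: c_gt0.
- by move=> y a Wy; exact: Ck_pderivable (cW _) Wy.
- by move=> y a b i j Wy; exact: Ck_pderivable (Ck_pd a (GW i j)) Wy.
- by move=> y a b Wy; exact: Ck_pderivable (Ck_pd a (cW _)) Wy.
- by move=> y a Wy; exact: Ck_pderivable (CkS (fgC _)) Wy.
- by move=> y a b Wy; exact: Ck_pderivable (Ck_pd a (fgC _)) Wy.
- exact: ltn_trans hn.
Qed.
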